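(* Let $k \geq 3$ be an integer, let $C_{4,k}$ be the $k$-uniform hypercycle with length four, and let $\mathcal{A}_{C_{4,k}}$ be its adjacency tensor. Then the $4k$-th order trace of $\mathcal{A}_{C_{4,k}}$ is $$\mathrm{Tr}_{4k}(\mathcal{A}_{C_{4,k}})=4k^{k-1}(k-1)^{3k-4}+56k^{2k-3}(k-1)^{2k-3}+64k^{3k-5}(k-1)^{k-2}+40k^{4k-8}.$$
   Context: A $k$-uniform hypergraph $H=(V,E)$ is a finite vertex set $V$ together with a set $E$ of $k$-element subsets of $V$ (edges). The $k$-uniform hypercycle with length $m$, $C_{m,k}$, has vertices $v_1,v_2,\ldots,v_{m(k-1)+1}$ with $v_1=v_{m(k-1)+1}$ identified (and no other identifications), and edges $e_i=\{v_{(i-1)(k-1)+1},v_{(i-1)(k-1)+2},\ldots,v_{i(k-1)+1}\}$ for $i=1,\ldots,m$; equivalently it is obtained from the cycle graph of length $m$ by adding $k-2$ new vertices to every edge. Thus $C_{4,k}$ has $n=4(k-1)$ vertices and $4$ edges. The adjacency tensor of a $k$-uniform hypergraph $H$ on $n$ vertices (labelled $1,\ldots,n$) is the $k$-order $n$-dimensional tensor $\mathcal{A}_H=(a_{i_1i_2\ldots i_k})$ with $a_{i_1\ldots i_k}=\frac{1}{(k-1)!}$ if $\{i_1,\ldots,i_k\}\in E$ and $0$ otherwise. For a $k$-order $n$-dimensional tensor $\mathcal{T}=(t_{i_1\ldots i_k})$ over $\mathbb{C}$, the $j$-th order trace is $$\mathrm{Tr}_{j}(\mathcal{T})=(k-1)^{n-1}\sum_{j_{1}+\cdots+j_{n}=j}\Big[\prod_{i=1}^{n}\frac{1}{(j_{i}(k-1))!}\Big(\sum_{l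 \in [n]^{k-1}}t_{il}\frac{\partial}{\partial x_{il}}\Big)^{j_{i}}\Big] \mathrm{tr}(X^{j(k-1)}),$$ where $X=(x_{ij})$ is an $n\times n$ matrix of independent variables, $[n]=\{1,\ldots,n\}$, for $l=l_2\cdots l_k$ one writes $t_{il}=t_{il_2\ldots l_k}$ and $\frac{\partial}{\partial x_{il}}=\frac{\partial}{\partial x_{il_2}}\cdots\frac{\partial}{\partial x_{il_k}}$, and $j_1,\ldots,j_n$ run over all nonnegative integers with sum $j$. *)

(* Defs.v *)
From mathcomp Require Import all_boot all_order all_algebra.
From mathcomp.multinomials Require Import mpoly.

Set Implicit Arguments.
Unset Strict Implicit.
Unset Printing Implicit Defensive.

Import GRing.Theory.
Local Open Scope ring_scope.

Definition hypergraph (n : nat) := {set {set 'I_n}}.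

Definition uniform (k n : nat) (H : hypergraph n) : Prop :=
  forall e, e \in H -> #|e| = k.

(* With 0-based labels, v_(j+1) is the vertex j %% (m * (k - 1)), so that       *)
(* v_(m(k-1)+1) is v_1; the i-th edge is {v_(i(k-1)+1), ..., v_(i(k-1)+k)}.     *)
Definition hypercycle_edge (m k : nat) (i : 'I_m) : {set 'I_(m * k.-1)} :=
  [set v : 'I_(m * k.-1) |
    [exists t : 'I_k, v == i * k.-1 + t %[mod m * k.-1]]]%N.

Definition hypercycle (m k : nat) : hypergraph (m * k.-1) :=
  [set hypercycle_edge k i | i : 'I_m].

Lemma hypercycle_uniform (m k : nat) :
  (1 < m)%N -> (1 < k)%N -> uniform k (hypercycle m k).
Proof.
move=> m_gt1 k_gt1 _ /imsetP[i _ ->].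
have k1_gt0 : (0 < k.-1)%N by rewrite -ltnS prednK // ltnW.
have n_gt0 : (0 < m * k.-1)%N by rewrite muln_gt0 k1_gt0 ltnW.
have k_le_n : (k <= m * k.-1)%N.
  apply: (@leq_trans (2 * k.-1)); last by rewrite leq_mul2r m_gt1 orbT.
  by rewrite mul2n -addnn -{1}(prednK (ltnW k_gt1)) -addn1 leq_add2l.
pose f (t : 'I_k) := Ordinal (ltn_pmod (i * k.-1 + t) n_gt0).
have f_inj : injective f.
  move=> s t /(congr1 val) /= /eqP; rewrite eqn_modDl => /eqP st.
  by apply: val_inj; move: st; rewrite !modn_small // (leq_trans (ltn_ord _)).
rewrite -[RHS](card_ord k) -(card_imset _ f_inj); apply: eq_card => v.
rewrite inE; apply/existsP/imsetP => [[t /eqP vt]|[t _ ->]]; exists t => //.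
  by apply: val_inj; rewrite /= -vt modn_small.
by rewrite /= modn_mod.
Qed.

Section TensorTrace.
Variable C : numClosedFieldType.

(* T i l is the entry t_(i l) = t_(i l_2 ... l_k), for 0 < k.                   *)
Definition tensor (k n : nat) := 'I_n -> (k.-1).-tuple 'I_n -> C.

Definition adjacency_tensor (k n : nat) (H : hypergraph n) : tensor k n :=
  fun i l => if [set v in i :: l] \in H then ((k.-1)`!%:R)^-1 else 0.

(* The variable x_(i j) is 'X_(mxvec_index i j), in n * n indeterminates.       *)
Definition generic_mx (n : nat) : 'M[{mpoly C[n * n]}]_n :=
  \matrix_(i, j) 'X_(mxvec_index i j).

Definition partial_il (n : nat) (i : 'I_n) (l : seq 'I_n)
    (p : {mpoly C[n * n]}) : {mpoly C[n * n]} :=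
  foldr (fun j q => q^`M(mxvec_index i j)) p l.

Definition row_operator (k n : nat) (T : tensor k n) (i : 'I_n)
    (p : {mpoly C[n * n]}) : {mpoly C[n * n]} :=
  \sum_(l : (k.-1).-tuple 'I_n) T i l *: partial_il i l p.

Definition trace_operator (k n : nat) (T : tensor k n) (j : 'I_n -> nat)
    (p : {mpoly C[n * n]}) : {mpoly C[n * n]} :=
  foldr (fun i q => ((j i * k.-1)`!%:R)^-1 *: iter (j i) (row_operator T i) q)
    p (enum 'I_n).

(* d (k - 1) derivations are applied to a form of degree d (k - 1), so the      *)
(* resulting polynomial is constant; _@_0%MM reads off its value. As the j_i    *)
(* add up to d, letting them range over 'I_d.+1 loses nothing.                  *)
Definition tensor_trace (k n : nat) (T : tensor k n) (d : nat) : C :=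
  ((k.-1) ^ n.-1)%:R *
  (\sum_(j : {ffun 'I_n -> 'I_d.+1} | (\sum_i j i)%N == d)
     trace_operator T (fun i => j i) (\tr (generic_mx n ^+ (d * k.-1))))@_0%MM.

End TensorTrace.

Arguments adjacency_tensor C k {n} H.
Arguments tensor_trace {C k n} T d.

(* Main.v *)
Require Import Defs.
From mathcomp Require Import all_boot all_order all_algebra.
From mathcomp.multinomials Require Import mpoly.
From mathcomp Require Import ring zify.

Set Implicit Arguments.
Unset Strict Implicit.
Unset Printing Implicit Defensive.

Import GRing.Theory Num.Theory.
Local Open Scope ring_scope.

(* The pairing <q, p> = sum_m q_m p_m m! turns the differential operators into
   polynomial multiplications, so the trace becomes a sum, over the numbers
   r_(v,e) of times an edge e is rooted at a vertex v, of numbers of closed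
   trails (with distinguished parallel arcs) in the digraph where each such
   rooting contributes the arcs v -> u, u in e \ {v}. By the BEST theorem that
   number is governed by a cofactor of I - P, where P is the transition matrix
   of the random walk. Here (k-1)(I - P) is a diagonal matrix minus a product of
   an n x 4 and a 4 x n matrix, so the sum of its principal cofactors reduces to
   that of a 4 x 4 matrix indexed by the edges. The digraph is balanced iff for
   some s_1 + ... + s_4 = 4 every vertex of degree one in e_i is a root s_i
   times, and the core vertex of e_(i-1) and e_i is a root s_i + t times for e_i
   and s_(i-1) - t times for e_(i-1), with t independent of i; this leaves 37
   configurations. *)

(** * Sums of principal cofactors *)

Definition row_delta (R : comNzRingType) n (a : 'I_n) (A : 'M[R]_n) : 'M[R]_n :=
  \matrix_(i, j) (if i == a then (j == a)%:R else A i j).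

Lemma deriv_prod_ord (R : comNzRingType) n (f : 'I_n -> {poly R}) :
  (\prod_i f i)^`() = \sum_j \prod_i (if i == j then (f i)^`() else f i).
Proof.
elim: n f => [|n IHn] f; first by rewrite !big_ord0 derivC.
rewrite big_ord_recl derivM IHn [in RHS]big_ord_recl; congr (_ + _).
  by rewrite [RHS]big_ord_recl eqxx; congr (_ * _); apply: eq_bigr.
rewrite mulr_sumr; apply: eq_bigr => j _; rewrite [RHS]big_ord_recl /=.
by congr (_ * _); apply: eq_bigr => i _; rewrite (inj_eq lift_inj).
Qed.

(** [\det (row_delta a A)] is the cofactor of [A] at [(a, a)]. In the Leibniz formula the product
    rule differentiates one row at a time, and the derivative of row [a] is the unit vector at
    [a]. *)
Lemma deriv_det_addX (R : comNzRingType) n (A : 'M[R]_n) :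
  (\det ('X%:M + map_mx polyC A))^`().[0] = \sum_a \det (row_delta a A).
Proof.
rewrite /determinant raddf_sum exchange_big /= horner_sum; apply: eq_bigr => s _.
have -> : (-1) ^+ perm.odd_perm s = ((-1) ^+ perm.odd_perm s)%:P :> {poly R}.
  by rewrite rmorph_sign.
rewrite mul_polyC derivZ hornerZ -mulr_sumr deriv_prod_ord horner_sum.
congr (_ * _); apply: eq_bigr => a _; rewrite horner_prod.
apply: eq_bigr => i _; rewrite !mxE; case: eqP => [->|_].
  by rewrite derivD derivMn derivX derivC addr0 hornerMn hornerC eq_sym.
by rewrite hornerD hornerMn hornerX mul0rn add0r hornerC.
Qed.

Lemma det_scale_row_delta (R : comNzRingType) n (c : R) (a : 'I_n) (A : 'M[R]_n) :
  \det (row_delta a (c *: A)) = c ^+ n.-1 * \det (row_delta a A).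
Proof.
pose d : 'rV_n := \row_i if i == a then 1 else c.
have -> : row_delta a (c *: A) = diag_mx d *m row_delta a A.
  apply/matrixP=> i j; rewrite mul_diag_mx !mxE.
  by case: eqP => // _; rewrite mul1r.
rewrite det_mulmx det_diag (bigD1 a) //= mxE eqxx mul1r; congr (_ * _).
rewrite (eq_bigr (fun=> c)) => [|i /negPf ia]; last by rewrite mxE ia.
by rewrite prodr_const cardC1 card_ord.
Qed.

(* The polynomial identity [det (c - pB) * c^m = det c * det (c - Bp)] needs no
   division because [[c, p], [B, 1]] * [[1, -p], [0, c]] is block triangular. *)
Lemma det_diag_sub_mul (R : comNzRingType) n m (d : 'rV[R]_n) (c : R)
    (P : 'M[R]_(n, m)) (B : 'M[R]_(m, n)) :
  diag_mx d *m P = c *: P ->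
  \det (diag_mx d - P *m B) * c ^+ m = (\prod_i d 0 i) * \det (c%:M - B *m P).
Proof.
move=> dP; pose K := block_mx (diag_mx d) P B 1%:M.
have detK : \det K = \det (diag_mx d - P *m B).
  have : K *m block_mx 1%:M 0 (- B) 1%:M = block_mx (diag_mx d - P *m B) P 0 1%:M.
    by rewrite mulmx_block !mulmx1 !mulmx0 !mul1mx !add0r mulmxN addrN.
  by move/(congr1 determinant); rewrite det_mulmx det_lblock det_ublock !det1 !mulr1.
rewrite -detK -det_diag.
have : K *m block_mx 1%:M (- P) 0 c%:M = block_mx (diag_mx d) 0 B (c%:M - B *m P).
  rewrite mulmx_block !mulmx1 !mulmx0 !mul1mx !addr0 !mulmxN dP mul_mx_scalar addNr.
  by rewrite addrC.
by move/(congr1 determinant); rewrite det_mulmx det_lblock det_ublock det1 mul1r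
  det_scalar.
Qed.

(** [det_diag_sub_mul] is applied over [{poly R}] after adding ['X] to [c] and to every entry of
    [d], and linear coefficients are compared. Both determinants vanish at 0, so the product rule
    leaves one term on each side. *)
Lemma sum_det_row_delta_diag_sub_mul (R : comNzRingType) n m (d : 'rV[R]_n) (c : R)
    (P : 'M[R]_(n, m)) (B : 'M[R]_(m, n)) :
    GRing.lreg c -> diag_mx d *m P = c *: P -> \det (c%:M - B *m P) = 0 ->
  (\sum_a \det (row_delta a (diag_mx d - P *m B))) * c ^+ m
    = (\prod_i d 0 i) * \sum_b \det (row_delta b (c%:M - B *m P)).
Proof.
move=> creg dP det0.
have detA0 : \det (diag_mx d - P *m B) = 0.
  have cmreg : GRing.lreg (c ^+ m) by apply: GRing.lregX.
  apply: cmreg; change (c ^+ m * \det (diag_mx d - P *m B) = c ^+ m * 0).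
  by rewrite mulr0 mulrC det_diag_sub_mul // det0 mulr0.
pose dX : 'rV[{poly R}]_n := \row_i ('X + (d 0 i)%:P).
have dPX : diag_mx dX *m map_mx polyC P = ('X + c%:P) *: map_mx polyC P.
  apply/matrixP => i j; have := congr1 (fun M : 'M_(n, m) => M i j) dP.
  by rewrite !mul_diag_mx !mxE !mulrDl -!polyCM => ->.
have := det_diag_sub_mul (map_mx polyC B) dPX.
have -> : diag_mx dX - map_mx polyC P *m map_mx polyC B
    = 'X%:M + map_mx polyC (diag_mx d - P *m B).
  rewrite -map_mxM; apply/matrixP => i j; rewrite !mxE polyCB polyCMn mulrnDl.
  by rewrite addrA.
have -> : ('X + c%:P)%:M - map_mx polyC B *m map_mx polyC P
    = 'X%:M + map_mx polyC (c%:M - B *m P).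
  rewrite -map_mxM; apply/matrixP => i j; rewrite !mxE polyCB polyCMn mulrnDl.
  by rewrite addrA.
move/(congr1 (fun p : {poly R} => p^`().[0])).
rewrite /= !derivM !hornerD !hornerM !deriv_det_addX.
have ev0 l (M : 'M[R]_l) : (\det ('X%:M + map_mx polyC M)).[0] = \det M.
  rewrite -[LHS]/(horner_eval 0 _) -det_map_mx; congr determinant.
  apply/matrixP => i j; rewrite !mxE /= horner_evalE hornerD hornerMn hornerX mul0rn.
  by rewrite add0r hornerC.
rewrite !ev0 det0 detA0 mul0r mulr0 add0r addr0 horner_exp hornerD hornerX hornerC add0r.
move=> ->; congr (_ * _); rewrite horner_prod; apply: eq_bigr => i _.
by rewrite mxE hornerD hornerX hornerC add0r.
Qed.

(** * The apolar pairing *)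

Definition mnm_fact n (m : 'X_{1..n}) : nat := \prod_i (m i)`!.

Lemma mnm_fact_addU n (m : 'X_{1..n}) i :
  mnm_fact (m + U_(i))%MM = ((m i).+1 * mnm_fact m)%N.
Proof.
rewrite /mnm_fact (bigD1 i) //= [in RHS](bigD1 i) //= mulnA.
rewrite mnmDE mnm1E eqxx addn1 factS; congr (_ * _)%N.
by apply: eq_bigr => j /negPf ji; rewrite mnmDE mnm1E eq_sym ji addn0.
Qed.

Section ApolarPairing.
Variables (R : comNzRingType) (n : nat).
Implicit Types (p q : {mpoly R[n]}) (m : 'X_{1..n}).

(** Only the support of [p] is summed over: additivity in [q] is immediate, additivity in [p] goes
    through [apolarE]. *)
Definition apolar q p : R := \sum_(m <- msupp p) q@_m * p@_m * (mnm_fact m)%:R.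

Lemma apolarX m p : apolar 'X_[m] p = p@_m * (mnm_fact m)%:R.
Proof.
rewrite /apolar; under eq_bigr do rewrite mcoeffX.
have [mp|mNp] := boolP (m \in msupp p).
  rewrite (bigD1_seq m) ?msupp_uniq //= eqxx mul1r big1 ?addr0 // => m' /negPf.
  by rewrite eq_sym => ->; rewrite !mul0r.
rewrite memN_msupp_eq0 // mul0r big1_seq // => m' /= m'p.
by case: eqP => [mm'|]; rewrite ?mul0r //; rewrite -mm' (negPf mNp) in m'p.
Qed.

Lemma apolar_suml (I : Type) (s : seq I) (P : pred I) (q : I -> {mpoly R[n]}) p :
  apolar (\sum_(i <- s | P i) q i) p = \sum_(i <- s | P i) apolar (q i) p.
Proof.
rewrite exchange_big; apply: eq_bigr => m _.
by rewrite raddf_sum !mulr_suml.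
Qed.

Lemma apolarZl c q p : apolar (c *: q) p = c * apolar q p.
Proof. by rewrite mulr_sumr; apply: eq_bigr => m _; rewrite mcoeffZ !mulrA. Qed.

Lemma apolarE q p : apolar q p = \sum_(m <- msupp q) q@_m * apolar 'X_[m] p.
Proof.
by rewrite {1}[q]mpolyE apolar_suml; apply: eq_bigr => m _; rewrite apolarZl.
Qed.

Lemma apolar_sumr (I : Type) (s : seq I) (P : pred I) (p : I -> {mpoly R[n]}) q :
  apolar q (\sum_(i <- s | P i) p i) = \sum_(i <- s | P i) apolar q (p i).
Proof.
rewrite apolarE; under [RHS]eq_bigr do rewrite apolarE.
rewrite exchange_big; apply: eq_bigr => m _ /=.
rewrite apolarX raddf_sum mulr_suml mulr_sumr.
by apply: eq_bigr => i _; rewrite apolarX.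
Qed.

Lemma apolarZr c q p : apolar q (c *: p) = c * apolar q p.
Proof.
rewrite apolarE [apolar q p]apolarE mulr_sumr; apply: eq_bigr => m _.
by rewrite !apolarX mcoeffZ -mulrA mulrCA.
Qed.

(** Multiplying the monomial [m] by ['X_i] multiplies [mnm_fact m] by [(m i).+1], the factor that
    the derivation puts on the coefficient. *)
Lemma apolar_mderiv q p i : apolar q p^`M(i) = apolar ('X_i * q) p.
Proof.
rewrite {2}[q]mpolyE mulr_sumr apolar_suml apolarE; apply: eq_bigr => m _.
rewrite -scalerAr apolarZl -mpolyXD !apolarX mcoeff_mderiv [(U_(i) + m)%MM]addmC mnm_fact_addU.
by rewrite -[_ *+ _]mulr_natr natrM -!mulrA.
Qed.

(** Dually, a factor ['X_i] on the right differentiates the monomial on the left. If [m i = 0], the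
    truncated [m - U_(i)] is harmless, both sides being 0. *)
Lemma apolarXU m i p :
  apolar 'X_[m] ('X_i * p) = (m i)%:R * apolar 'X_[m - U_(i)] p.
Proof.
rewrite !apolarX; case: (posnP (m i)) => [mi0|mi_gt0].
  rewrite mi0 mul0r mcoeffM big1 ?mul0r // => -[m1 m2] /= /eqP mE.
  rewrite mcoeffX; case: eqP => [m1E|_]; last by rewrite mul0r.
  by have := congr1 (fun m' : 'X_{1..n} => m' i) mE; rewrite mi0 mnmDE -m1E mnm1E eqxx.
have {1 2}-> : m = (m - U_(i) + U_(i))%MM.
  apply/esym/submK/mnm_lepP => j; rewrite mnm1E.
  by case: eqP => // <-.
rewrite mnm_fact_addU ['X_i * p]mulrC [(_ + U_(i))%MM]addmC mcoeffMX mnmBE mnm1E eqxx subn1 prednK //.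
by rewrite natrM mulrCA.
Qed.

Lemma apolar1 p : apolar 1 p = p@_0.
Proof.
rewrite -mpolyX0 apolarX /mnm_fact big1 ?mulr1 // => i _.
by rewrite mnm0E.
Qed.

End ApolarPairing.

(** * Trace operators as polynomial multiplications *)

Section TraceOperator.
Variables (C : numClosedFieldType) (k n : nat) (T : tensor C k n).

(** The symbol of [row_operator]: each derivation is replaced by its variable. *)
Definition row_form (i : 'I_n) : {mpoly C[n * n]} :=
  \sum_(l : (k.-1).-tuple 'I_n) T i l *: \prod_(j <- l) 'X_(mxvec_index i j).

Lemma apolar_row_operator q p i :
  apolar q (row_operator T i p) = apolar (row_form i * q) p.
Proof.
rewrite /row_operator /row_form apolar_sumr mulr_suml apolar_suml.
apply: eq_bigr => l _; rewrite apolarZr -scalerAl apolarZl; congr (_ * _).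
elim: (val l) q => [|j s IHs] q /=; first by rewrite big_nil mul1r.
by rewrite apolar_mderiv IHs big_cons mulrCA mulrA.
Qed.

(** The constant term is the pairing with 1, and each operator moved across the pairing becomes a
    factor on the left. *)
Lemma mcoeff0_trace_operator (j : 'I_n -> nat) p :
  (trace_operator T j p)@_0 =
    apolar (\prod_i (((j i * k.-1)`!%:R)^-1 *: row_form i ^+ j i)) p.
Proof.
rewrite -apolar1 /trace_operator -[\prod_i _]mulr1.
rewrite -(big_enum _ _ 'I_n) /=.
elim: (enum _) {-2}(1 : {mpoly C[n * n]}) => [|i s IHs] q /=.
  by rewrite big_nil mul1r.
rewrite big_cons apolarZr.
have iterE d r : apolar q (iter d (row_operator T i) r) =
                 apolar (row_form i ^+ d * q) r.
  elim: d q => [|d IHd] q' /=; first by rewrite mul1r.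
  by rewrite apolar_row_operator IHd exprSr mulrA.
rewrite iterE IHs -apolarZl; congr apolar.
by rewrite -!scalerAl mulrCA mulrA.
Qed.

End TraceOperator.

(** * Eulerian trails and the BEST theorem *)

Section Eulerian.
Variables (C : numClosedFieldType) (n : nat).
Implicit Types (m : 'X_{1..n * n}) (i j a b c : 'I_n).

Definition arcs m i j : nat := m (mxvec_index i j).
Definition outdeg m i : nat := (\sum_j arcs m i j)%N.
Definition indeg m j : nat := (\sum_i arcs m i j)%N.

Definition trail_balanced m a b :=
  forall i, (outdeg m i + (i == b) = indeg m i + (i == a))%N.

(* This counts the walks from a to b using each arc with its multiplicity, the
   parallel arcs being distinguished. *)
Definition trails m d a b : C := apolar 'X_[m] ((generic_mx C n ^+ d) a b).

Lemma arcsDU m a c i j :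
  arcs (m + U_(mxvec_index a c))%MM i j = (arcs m i j + ((i == a) && (j == c)))%N.
Proof.
rewrite /arcs mnmDE mnm1E eq_sym (inj_eq (@cast_ord_inj _ _ _)).
by rewrite (inj_eq enum_rank_inj).
Qed.

Lemma outdegDU m a c i :
  outdeg (m + U_(mxvec_index a c))%MM i = (outdeg m i + (i == a))%N.
Proof.
rewrite /outdeg; under eq_bigr do rewrite arcsDU.
rewrite big_split /=; congr (_ + _)%N; case: (i == a) => /=; last by rewrite big1.
by rewrite (bigD1 c) //= eqxx big1 // => j /negPf ->.
Qed.

Lemma indegDU m a c j :
  indeg (m + U_(mxvec_index a c))%MM j = (indeg m j + (j == c))%N.
Proof.
rewrite /indeg; under eq_bigr do rewrite arcsDU.
rewrite big_split /=; congr (_ + _)%N; rewrite (bigD1 a) //= eqxx /=.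
by rewrite big1 ?addn0 // => i /negPf ->.
Qed.

Lemma trails0 m a b : trails m 0 a b = ((m == 0%MM) && (a == b))%:R.
Proof.
rewrite /trails expr0 mxE apolarX mcoeffMn mcoeff1.
case: eqP => [->|] /=; last by rewrite mul0rn mul0r.
by rewrite /mnm_fact big1 ?mulr1 // => i _; rewrite mnm0E.
Qed.

(** The first arc of the trail is split off. Where [arcs m a c = 0] the truncated subtraction does
    no harm, since the term vanishes. *)
Lemma trailsS m d a b :
  trails m d.+1 a b =
    \sum_c (arcs m a c)%:R * trails (m - U_(mxvec_index a c)) d c b.
Proof.
rewrite /trails exprS mxE apolar_sumr; apply: eq_bigr => c _.
by rewrite mxE apolarXU.
Qed.

Lemma arcs_gt0 m a c : (0 < arcs m a c)%N ->
  {m' | m = (m' + U_(mxvec_index a c))%MM & (m - U_(mxvec_index a c))%MM = m'}.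
Proof.
move=> ac_gt0; exists (m - U_(mxvec_index a c))%MM => //.
apply/esym/submK/mnm_lepP => j; rewrite mnm1E.
by case: eqP => // <-.
Qed.

Lemma trail_balancedDU m a b c :
  trail_balanced (m + U_(mxvec_index a c))%MM a b <-> trail_balanced m c b.
Proof.
split=> bal i; have := bal i; rewrite outdegDU indegDU; lia.
Qed.

(** Some first arc [a -> c] leaves a nonzero number of trails from [c], and [trail_balancedDU]
    carries the degree condition back to [a]. *)
Lemma trails_unbalanced m d a b : trails m d a b != 0 -> trail_balanced m a b.
Proof.
elim: d m a => [|d IHd] m a.
  rewrite trails0 pnatr_eq0 eqb0 negbK => /andP[/eqP-> /eqP->] i.
  by congr addn; rewrite /outdeg /indeg !big1 // => j _; rewrite /arcs mnm0E.
rewrite trailsS => /eqP nz; have [c|all0] := pickP [pred c | (arcs m a c)%:R *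
    trails (m - U_(mxvec_index a c)) d c b != 0]; last first.
  by case: nz; apply: big1 => c _; have /negbFE/eqP := all0 c.
rewrite /= mulf_eq0 negb_or pnatr_eq0 -lt0n => /andP[/arcs_gt0[m' -> ->]].
by move/IHd => bal; apply/trail_balancedDU.
Qed.

(** This is I - P for the random walk along the arcs. As division by 0 gives 0, a vertex without
    outgoing arcs gets a row of the identity. *)
Definition walk_laplacian m : 'M[C]_n :=
  \matrix_(i, j) ((i == j)%:R - (arcs m i j)%:R / (outdeg m i)%:R).

Lemma det_row_delta_expand (a b : 'I_n) (A : 'M[C]_n) : b != a ->
  \det (row_delta b A) = \sum_j A a j * cofactor (row_delta b A) a j.
Proof.
move=> /negPf ba; rewrite (expand_det_row _ a); apply: eq_bigr => j _.
by rewrite mxE eq_sym ba.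
Qed.

Lemma cofactor_eq_row (R : comNzRingType) a j (A B : 'M[R]_n) :
  (forall i, i != a -> A i =1 B i) -> cofactor A a j = cofactor B a j.
Proof.
move=> AB; rewrite /cofactor; congr (_ * \det _); apply/matrixP => i i'.
by rewrite !mxE AB // eq_sym neq_lift.
Qed.

Lemma walk_laplacianDU m a c i j : i != a ->
  walk_laplacian (m + U_(mxvec_index a c))%MM i j = walk_laplacian m i j.
Proof.
by move=> /negPf ia; rewrite !mxE arcsDU outdegDU ia !addn0.
Qed.

Lemma mdeg_outdeg m : mdeg m = (\sum_i outdeg m i)%N.
Proof.
rewrite mdegE pair_bigA /= (reindex _ (curry_mxvec_bij n n)) /=.
by apply: eq_bigr => -[i j] _.
Qed.

(* BEST theorem: the number of spanning arborescences rooted at b is the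
   determinant, up to the factor prod_(i != b) outdeg i. *)
Theorem trails_det m a b : trail_balanced m a b ->
  trails m (mdeg m) a b =
    (\prod_i ((outdeg m i)`!)%:R) * \det (row_delta b (walk_laplacian m)).
Proof.
move dE: (mdeg m) => d; elim: d m a dE => [|d IHd] m a mdegm bal.
  have m0 : m = 0%MM by apply/eqP; rewrite -mdeg_eq0 mdegm.
  have out0 i : outdeg m i = 0%N by rewrite m0 /outdeg big1 // => j _; rewrite /arcs mnm0E.
  have in0 i : indeg m i = 0%N by rewrite m0 /indeg big1 // => j _; rewrite /arcs mnm0E.
  have ab : a = b.
    by have := bal a; rewrite out0 in0 eqxx; case: eqP => //=.
  rewrite trails0 m0 ab !eqxx big1 ?mul1r => [|i _]; last by rewrite -m0 out0.
  rewrite -[LHS](det1 C n); congr determinant; apply/matrixP => i j; rewrite !mxE.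
  rewrite /arcs mnm0E mul0r subr0; by case: (eqVneq i b) => [->|_] //; rewrite eq_sym.
set K := \prod_i _; set D0 := \det _.
pose D c : C := \det (row_delta b (walk_laplacian (m - U_(mxvec_index a c))%MM)).
(* Deleting an arc that leaves [a] divides the product of factorials by [outdeg m a]. *)
have termE c : (arcs m a c)%:R * trails (m - U_(mxvec_index a c)) d c b =
    K / (outdeg m a)%:R * ((arcs m a c)%:R * D c).
  have [->|/arcs_gt0[m' mE m'E]] := posnP (arcs m a c); first by rewrite !mul0r mulr0.
  rewrite /D m'E IHd.
  - have -> : K = (outdeg m a)%:R * \prod_i ((outdeg m' i)`!)%:R.
      rewrite /K (bigD1 a) //= [in RHS](bigD1 a) //= mulrA -natrM.
      rewrite mE outdegDU eqxx addn1 -factS; congr (_ * _).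
      by apply: eq_bigr => i /negPf ia; rewrite outdegDU ia addn0.
    rewrite [_ * \prod_i _]mulrC mulfK; last first.
      by rewrite pnatr_eq0 mE outdegDU eqxx addn1.
    by rewrite mulrCA.
  - by apply/eqP; rewrite -eqSS -mdegm mE mdegD mdeg1 addn1.
  - by apply/(trail_balancedDU _ a); rewrite -mE.
rewrite trailsS (eq_bigr _ (fun c _ => termE c)) -mulr_sumr.
have sum_arcs : \sum_c (arcs m a c)%:R = (outdeg m a)%:R :> C by rewrite -natr_sum.
(* If deleting a first arc never changes the determinant, averaging over the arcs that leave [a]
   returns [D0]. *)
have sum_const : (0 < outdeg m a)%N -> (forall c, (0 < arcs m a c)%N -> D c = D0) ->
    K / (outdeg m a)%:R * (\sum_c (arcs m a c)%:R * D c) = K * D0.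
  move=> out_gt0 DE; rewrite (eq_bigr (fun c => (arcs m a c)%:R * D0)) => [|c _].
    by rewrite -mulr_suml sum_arcs mulrA divfK // pnatr_eq0 -lt0n.
  by have [->|/DE->//] := posnP (arcs m a c); rewrite !mul0r.
have rows_eq c i j : i != a -> (0 < arcs m a c)%N ->
    walk_laplacian (m - U_(mxvec_index a c))%MM i j = walk_laplacian m i j.
  by move=> ia /arcs_gt0[m' -> ->]; rewrite walk_laplacianDU.
(* If [a = b], the deletion affects only row [b], which [row_delta] overwrites. *)
have [ab|ab] := eqVneq a b.
  have [out0|out_gt0] := posnP (outdeg m a); last first.
    apply: sum_const => // c ac_gt0; congr determinant; apply/matrixP => i j.
    by rewrite !mxE -ab; case: eqVneq => // ia; have := rows_eq _ _ j ia ac_gt0; rewrite !mxE.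
  rewrite out0 invr0 mulr0 mul0r; apply/esym/eqP; rewrite mulf_eq0; apply/orP; right.
  rewrite /D0 -det_tr; apply/det0P.
  (* No arc touches [b], so no trail exists and the determinant must vanish. The indicator of the
     vertices with outgoing arcs is in the kernel, because by balance the head of every arc has an
     outgoing arc. *)
  exists (\row_i (0 < outdeg m i)%N%:R).
    apply/eqP => /rowP v0; suff : mdeg m = 0%N by rewrite mdegm.
    rewrite mdeg_outdeg big1 // => i _; apply/eqP; rewrite -leqn0 leqNgt.
    by have /eqP := v0 i; rewrite !mxE pnatr_eq0 eqb0.
  apply/rowP => i; rewrite !mxE.
  have [-> |ib] := eqVneq i b.
    rewrite (bigD1 b) //= !mxE -ab out0 mul0r add0r big1 // => j /negPf jb.
    by rewrite !mxE eqxx jb mulr0.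
  under eq_bigr do rewrite !mxE (negPf ib) mulrBr.
  rewrite sumrB (bigD1 i) //= eqxx mulr1 big1 ?addr0 => [|j /negPf ji]; last first.
    by rewrite eq_sym ji mulr0.
  rewrite (eq_bigr (fun j => (arcs m i j)%:R / (outdeg m i)%:R)) => [|j _].
    rewrite -mulr_suml -natr_sum; have [out_i0|out_i] := posnP (outdeg m i).
      by rewrite out_i0 invr0 mulr0 subrr.
    by rewrite divff ?subrr // pnatr_eq0 -lt0n.
  have [->|arc_gt0] := posnP (arcs m i j); first by rewrite !mul0r mulr0.
  have -> : (0 < outdeg m j)%N; last by rewrite mul1r.
  have := bal j; rewrite ab => /addIn ->.
  by rewrite /indeg (bigD1 i) //= ltn_addr.
have out_a : outdeg m a = (indeg m a).+1.
  by have := bal a; rewrite eqxx (negPf ab) addn0 addn1.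
have cof_eq c j : (0 < arcs m a c)%N ->
    cofactor (row_delta b (walk_laplacian (m - U_(mxvec_index a c))%MM)) a j =
    cofactor (row_delta b (walk_laplacian m)) a j.
  move=> ac_gt0; apply: cofactor_eq_row => i ia j'; rewrite mxE [RHS]mxE.
  by case: eqP => // _; apply: rows_eq.
have ba : b != a by rewrite eq_sym.
(* With no arc into [a], balance gives [a] a single outgoing arc. Before and after its deletion,
   column [a] is a unit vector, so both determinants equal the same cofactor. *)
have [in0|in_gt0] := posnP (indeg m a).
  apply: sum_const => [|c ac_gt0]; first by rewrite out_a.
  have in_arcs i : arcs m i a = 0%N.
    by move/eqP: in0; rewrite /indeg sum_nat_eq0 => /forallP/(_ i)/eqP.
  have colE m' : (forall i, i != a -> arcs m' i a = 0%N) -> arcs m' a a = 0%N ->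
      \det (row_delta b (walk_laplacian m')) = cofactor (row_delta b (walk_laplacian m')) a a.
    move=> m'i m'a; rewrite (expand_det_col _ a) (bigD1 a) //= big1 ?addr0.
      by rewrite !mxE (negPf ab) eqxx m'a mul0r subr0 mul1r.
    move=> i ia; rewrite !mxE (negPf ia) m'i // mul0r subr0 (negPf ab).
    by case: ifP; rewrite mul0r.
  have in_arcs' i : arcs (m - U_(mxvec_index a c))%MM i a = 0%N.
    by have := in_arcs i; rewrite /arcs mnmBE => ->.
  by rewrite /D /D0 !colE ?cof_eq.
have out_gt1 : (outdeg m a)%:R - 1 != 0 :> C.
  by rewrite out_a -addn1 natrD addrK pnatr_eq0 -lt0n.
have out_neq0 : (outdeg m a)%:R != 0 :> C by rewrite out_a pnatr_eq0.
(* The cofactors along row [a] do not see that row, so it suffices that row [a] is the average, over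
   the arcs [a -> c], of the rows left after deletion. Those have denominator [outdeg m a - 1],
   which is nonzero here. *)
rewrite /D0 (det_row_delta_expand _ ba) -mulrA; congr (_ * _).
rewrite (eq_bigr (fun c => \sum_j ((arcs m a c)%:R *
    walk_laplacian (m - U_(mxvec_index a c))%MM a j) *
    cofactor (row_delta b (walk_laplacian m)) a j)) => [|c _]; last first.
  have [->|ac_gt0] := posnP (arcs m a c).
    by rewrite mul0r big1 // => j _; rewrite !mul0r.
  rewrite /D (det_row_delta_expand _ ba) mulr_sumr; apply: eq_bigr => j _.
  by rewrite cof_eq // mulrA.
rewrite exchange_big mulr_sumr; apply: eq_bigr => j _ /=; rewrite -mulr_suml mulrA.
congr (_ * _).
rewrite (eq_bigr (fun c => (arcs m a c)%:R * ((a == j)%:R - (arcs m a j)%:R /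
    ((outdeg m a)%:R - 1)) + (arcs m a c)%:R * (c == j)%:R / ((outdeg m a)%:R - 1)))
  => [|c _]; last first.
  have [->|/arcs_gt0[m' mE ->]] := posnP (arcs m a c); first by rewrite !mul0r addr0.
  have mE1 : (outdeg m a)%:R - 1 = (outdeg m' a)%:R :> C.
    by rewrite mE outdegDU eqxx natrD addrK.
  have mE2 : (arcs m a j)%:R = (arcs m' a j)%:R + (j == c)%:R :> C.
    by rewrite mE arcsDU eqxx natrD.
  by rewrite !mxE mE1 mE2 [c == j]eq_sym; ring.
rewrite big_split /= -mulr_suml sum_arcs -mulr_suml.
rewrite [X in _ + X / _](bigD1 j) //= eqxx mulr1 big1 ?addr0 => [|c /negPf ->]; last first.
  by rewrite mulr0.
rewrite !mxE; field.
by rewrite out_gt1 out_neq0.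
Qed.

End Eulerian.

(** * Digraphs of rooted edges *)

Section Rooting.
Variables (C : numClosedFieldType) (n q mu : nat) (E : 'I_mu -> {set 'I_n}).
Hypothesis q_gt0 : (0 < q)%N.
Hypothesis cardE : forall e, #|E e| = q.+1.
Implicit Types (r : 'I_n -> 'I_mu -> nat) (v u : 'I_n) (e f : 'I_mu).

Definition star v (A : {set 'I_n}) : 'X_{1..n * n} :=
  (\sum_(u in A :\ v) U_(mxvec_index v u))%MM.

(* r v e is the number of times that the edge e is rooted at the vertex v. *)
Definition rooting r : 'X_{1..n * n} :=
  (\sum_v \sum_e star v (E e) *+ r v e)%MM.

Definition rootdeg r v : nat := (\sum_e r v e)%N.

Lemma arcs_star v (A : {set 'I_n}) i u :
  arcs (star v A) i u = ((i == v) && (u \in A :\ v)).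
Proof.
rewrite /arcs /star mnm_sumE; have [uA|uNA] := boolP (u \in A :\ v).
  rewrite andbT (bigD1 u) //= big1 => [|w /andP[_ /negPf wu]].
    rewrite addn0 mnm1E (inj_eq (@cast_ord_inj _ _ _)) (inj_eq enum_rank_inj).
    by rewrite xpair_eqE eqxx andbT eq_sym.
  rewrite mnm1E (inj_eq (@cast_ord_inj _ _ _)) (inj_eq enum_rank_inj).
  by rewrite xpair_eqE wu andbF.
rewrite andbF big1 // => w wA.
rewrite mnm1E (inj_eq (@cast_ord_inj _ _ _)) (inj_eq enum_rank_inj) xpair_eqE.
by case: (eqVneq w u) uNA => [<-|]; rewrite ?wA ?andbF.
Qed.

Lemma arcs_rooting r v u :
  arcs (rooting r) v u = (\sum_e r v e * (u \in E e :\ v))%N.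
Proof.
rewrite /arcs /rooting mnm_sumE (bigD1 v) //= [X in (_ + X)%N]big1 ?addn0.
  rewrite mnm_sumE; apply: eq_bigr => e _.
  by rewrite mulmnE -[star _ _ _]/(arcs _ _ _) arcs_star eqxx mulnC.
move=> w /negPf wv; rewrite mnm_sumE big1 // => e _.
by rewrite mulmnE -[star _ _ _]/(arcs _ _ _) arcs_star eq_sym wv.
Qed.

Section Supported.
Variable r : 'I_n -> 'I_mu -> nat.
Hypothesis r_supp : forall v e, v \notin E e -> r v e = 0%N.

Lemma outdeg_rooting v : outdeg (rooting r) v = (rootdeg r v * q)%N.
Proof.
rewrite /outdeg; under eq_bigr do rewrite arcs_rooting.
rewrite exchange_big big_distrl /=; apply: eq_bigr => e _; rewrite -big_distrr /=.
have [vE|/r_supp->] := boolP (v \in E e); last by rewrite !mul0n.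
congr (_ * _)%N; rewrite -big_mkcond sum1_card.
by have := cardsD1 v (E e); rewrite vE cardE => -[].
Qed.

(** Rootings at [u] itself give no arc into [u]; [rootdeg r u] supplies them, so that every rooting
    of an edge through [u] counts once. *)
Lemma indeg_rooting u :
  (indeg (rooting r) u + rootdeg r u = \sum_(e | u \in E e) \sum_v r v e)%N.
Proof.
rewrite exchange_big (bigD1 u) //= addnC /indeg.
under eq_bigr do rewrite arcs_rooting.
rewrite (bigD1 u) //= addnA [X in (_ + X + _)%N]big1 ?addn0; last first.
  by move=> e _; rewrite !inE eqxx muln0.
congr (_ + _)%N.
  rewrite /rootdeg [in RHS]big_mkcond; apply: eq_bigr => e _.
  by case: ifPn => // /r_supp.
apply: eq_bigr => v vu; rewrite [RHS]big_mkcond /=; apply: eq_bigr => e _.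
by rewrite !inE eq_sym vu; case: (u \in E e); rewrite ?muln1 ?muln0.
Qed.

Lemma mdeg_rooting : mdeg (rooting r) = ((\sum_v rootdeg r v) * q)%N.
Proof.
by rewrite mdeg_outdeg big_distrl; apply: eq_bigr => v _; apply: outdeg_rooting.
Qed.

Definition root_share : 'M[C]_(n, mu) := \matrix_(v, e) ((r v e)%:R / (rootdeg r v)%:R).
Definition incidence : 'M[C]_(mu, n) := \matrix_(e, v) (v \in E e)%:R.
(** The small matrix of [sum_det_row_delta_diag_sub_mul], with [c = q.+1]. *)
Definition edge_laplacian : 'M[C]_mu := q.+1%:R%:M - incidence *m root_share.

Lemma sum_root_share v : \sum_e root_share v e = (0 < rootdeg r v)%N%:R.
Proof.
under eq_bigr do rewrite mxE; rewrite -mulr_suml -natr_sum.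
have [jv0|jv_gt0] := posnP (rootdeg r v); first by rewrite jv0 invr0 mulr0.
by rewrite divff // pnatr_eq0 -lt0n.
Qed.

(** [root_share *m incidence] also counts [v] among the vertices of its own edges. The shares at [v]
    sum to 1 if [v] is a root and to 0 otherwise, which is what the diagonal adds to [q]. *)
Lemma walk_laplacian_rooting :
  q%:R *: walk_laplacian C (rooting r) =
    diag_mx (\row_v (q + (0 < rootdeg r v))%N%:R) - root_share *m incidence.
Proof.
apply/matrixP => v u; rewrite !mxE outdeg_rooting arcs_rooting natr_sum.
have q_neq0 : q%:R != 0 :> C by rewrite pnatr_eq0 -lt0n.
have -> : q%:R * ((v == u)%:R - (\sum_e (r v e * (u \in E e :\ v))%:R) /
    (rootdeg r v * q)%:R) =
    q%:R * (v == u)%:R - \sum_e (r v e)%:R / (rootdeg r v)%:R * (u \in E e :\ v)%:R :> C.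
  rewrite mulrBr mulr_suml mulr_sumr; congr (_ - _); apply: eq_bigr => e _.
  by rewrite !natrM invfM -[RHS](mulfK q_neq0); ring.
have [<-|/negPf vu] := eqVneq v u.
  rewrite mulr1 mulr1n big1 => [|e _]; last by rewrite !inE eqxx mulr0.
  rewrite subr0 natrD -sum_root_share -[LHS]addr0 -addrA; congr (_ + _).
  apply/esym/eqP; rewrite subr_eq0; apply/eqP/eq_bigr => e _; rewrite !mxE.
  by have [|/r_supp->] := boolP (v \in E e); rewrite ?mulr1 // !mul0r.
rewrite mulr0 mulr0n; congr (_ - _); apply: eq_bigr => e _.
by rewrite !mxE !inE eq_sym vu.
Qed.

Hypothesis bal : forall v, outdeg (rooting r) v = indeg (rooting r) v.

Lemma rootdeg_balanced v :
  (q.+1 * rootdeg r v = \sum_(e | v \in E e) \sum_u r u e)%N.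
Proof. by rewrite -indeg_rooting -bal outdeg_rooting mulSn mulnC addnC. Qed.

(** A kernel vector assigns to [e] the number of its vertices that are roots. By [rootdeg_balanced],
    all vertices of an edge that is rooted somewhere are roots, so the entry of such an edge is
    [q.+1]. *)
Lemma det_edge_laplacian : (0 < \sum_v rootdeg r v)%N -> \det edge_laplacian = 0.
Proof.
move=> tot_gt0; apply/eqP; rewrite -det_tr; apply/det0P.
pose x e : C := \sum_(v in E e) (0 < rootdeg r v)%N%:R.
have x_act e v : (0 < r v e)%N -> x e = q.+1%:R.
  move=> rve; rewrite -(cardE e) -sumr_const; apply: eq_bigr => u uE.
  have: (0 < q.+1 * rootdeg r u)%N; last by rewrite muln_gt0 => /andP[_ ->].
  by rewrite rootdeg_balanced (bigD1 e) //= (bigD1 v) //= -addnA ltn_addr.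
exists (\row_e x e).
  apply/eqP => /rowP x0; move: tot_gt0; rewrite lt0n => /negP; apply.
  rewrite sum_nat_eq0; apply/forallP => v; rewrite sum_nat_eq0.
  apply/forallP => e /=; rewrite -leqn0 leqNgt; apply/negP => /x_act xe.
  by have /eqP := x0 e; rewrite !mxE xe pnatr_eq0.
apply/rowP => e; rewrite !mxE.
under eq_bigr do rewrite !mxE mulrBr.
rewrite sumrB (bigD1 e) //= eqxx big1 ?addr0 => [|f /negPf fe]; last first.
  by rewrite eq_sym fe mulr0.
apply/eqP; rewrite subr_eq0; apply/eqP.
under [RHS]eq_bigr do rewrite mulr_sumr.
rewrite exchange_big /= /x mulr_suml big_mkcond; apply: eq_bigr => v _ /=.
case: ifPn => vE; last first.
  by rewrite big1 // => f _; rewrite mxE (negPf vE) mul0r mulr0.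
rewrite -sum_root_share mulr_suml; apply: eq_bigr => f _; rewrite !mxE vE mul1r.
have [->|/x_act xf] := posnP (r v f); first by rewrite !mul0r mulr0.
by rewrite -/(x f) xf mulrC.
Qed.

(** The BEST theorem turns the trails into principal cofactors; the factor [q ^ n.-1] rescales the
    walk Laplacian to its factored form, whose cofactor sum passes to the edges. *)
Lemma sum_trails_rooting : (0 < \sum_v rootdeg r v)%N ->
  q%:R ^+ n.-1 * (\sum_a trails C (rooting r) (mdeg (rooting r)) a a) * q.+1%:R ^+ mu =
    (\prod_v ((rootdeg r v * q)`!)%:R) * (\prod_v (q + (0 < rootdeg r v))%N%:R) *
    \sum_e \det (row_delta e edge_laplacian).
Proof.
move=> tot_gt0.
rewrite (eq_bigr _ (fun a _ => trails_det C (a := a) (b := a)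
  (fun i => congr1 (addn^~ _) (bal i)))).
rewrite -mulr_sumr mulrCA mulr_sumr.
rewrite (eq_bigr _ (fun a _ => esym (det_scale_row_delta _ a _))).
rewrite walk_laplacian_rooting.
rewrite -!mulrA sum_det_row_delta_diag_sub_mul ?det_edge_laplacian //.
- congr (_ * _); last congr (_ * _); apply: eq_bigr => v _.
    by rewrite outdeg_rooting.
  by rewrite mxE.
- by apply: mulfI; rewrite pnatr_eq0.
- apply/matrixP => v e; rewrite mul_diag_mx !mxE.
  have [jv0|jv_gt0] := posnP (rootdeg r v); first by rewrite jv0 invr0 !mulr0.
  by rewrite addn1.
Qed.

End Supported.
End Rooting.

(** * Row forms of an adjacency tensor *)

Lemma mpolyX_star (R : comNzRingType) n (v : 'I_n) (A : {set 'I_n}) :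
  'X_[star v A] = \prod_(u in A :\ v) 'X_(mxvec_index v u) :> {mpoly R[n * n]}.
Proof.
rewrite /star; elim/big_rec2: _ => [|u p m _ <-]; first by rewrite mpolyX0.
by rewrite mpolyXD.
Qed.

(** By cardinality, [k] entries that together with [i] fill [e] can neither repeat nor equal [i]. *)
Lemma set_cons_tuple n k (e : {set 'I_n}) (i : 'I_n) (l : k.-tuple 'I_n) :
  #|e| = k.+1 -> i \in e ->
  ([set v in i :: l] == e) = all (mem (e :\ i)) l && uniq l.
Proof.
move=> card_e ie; apply/eqP/andP => [le|[/allP l_sub l_uniq]].
  have : uniq (i :: l).
    by apply/card_uniqP; rewrite /= size_tuple -card_e -le cardsE.
  move=> /= /andP[iNl ->]; split=> //; apply/allP => u ul.
  by rewrite /= !inE -le inE in_cons ul orbT andbT; apply: contraNneq iNl => <-.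
have iNl : i \notin val l by apply/negP => /l_sub; rewrite !inE eqxx.
have uniq_il : uniq (i :: l) by rewrite /= iNl.
apply/eqP; rewrite eqEcard card_e; apply/andP; split.
  apply/subsetP => v; rewrite inE in_cons => /predU1P[->//|/l_sub].
  by rewrite !inE => /andP[].
by rewrite cardsE (card_uniqP uniq_il) /= size_tuple.
Qed.

(** The tuples are the orderings of [e :\ i]; all give the same monomial, and their number cancels
    the tensor entry. *)
Lemma sum_orderings (C : numClosedFieldType) n k (e : {set 'I_n}) (i : 'I_n) :
  #|e| = k.+1 ->
  \sum_(l : k.-tuple 'I_n | [set v in i :: l] == e)
     (k`!%:R)^-1 *: \prod_(j <- l) 'X_(mxvec_index i j)
    = (if i \in e then 'X_[star i e] else 0) :> {mpoly C[n * n]}.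
Proof.
move=> card_e; case: ifPn => ie; last first.
  rewrite big1 // => l /eqP le; case/negP: ie.
  by rewrite -le inE mem_head.
have card_ei : #|e :\ i| = k by have := cardsD1 i e; rewrite ie card_e => -[].
rewrite (eq_bigr (fun=> (k`!%:R)^-1 *: 'X_[star i e])) => [|l]; last first.
  rewrite set_cons_tuple // => /andP[/allP l_sub l_uniq].
  rewrite mpolyX_star -big_enum; congr (_ *: _); apply: perm_big.
  apply: uniq_perm; rewrite ?enum_uniq // => u; rewrite mem_enum.
  have l_sub' : {subset l <= enum (e :\ i)} by move=> w /l_sub; rewrite mem_enum.
  have [|_ ->] := uniq_min_size l_uniq l_sub'; last by rewrite mem_enum.
  by rewrite -cardE card_ei size_tuple.
rewrite (eq_bigl _ _ (fun l : k.-tuple _ => set_cons_tuple l card_e ie)).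
rewrite sumr_const -[#|_|]cardsE card_uniq_tuples (_ : #|_| = k); last first.
  by rewrite -card_ei; apply: eq_card => u.
rewrite ffactnn -scaler_nat scalerA divff ?scale1r //.
by rewrite pnatr_eq0 -lt0n fact_gt0.
Qed.

Lemma row_form_adjacency (C : numClosedFieldType) n k (H : hypergraph n) (i : 'I_n) :
  uniform k.+1 H ->
  row_form (adjacency_tensor C k.+1 H) i = \sum_(e in H | i \in e) 'X_[star i e].
Proof.
move=> Hk; rewrite big_mkcondr /=.
rewrite (eq_bigr (fun e : {set 'I_n} => \sum_(l : k.-tuple 'I_n | [set v in i :: l] == e)
     (k`!%:R)^-1 *: \prod_(j <- l) 'X_(mxvec_index i j))) => [|e /Hk card_e]; last first.
  by rewrite sum_orderings.
rewrite (exchange_big_dep predT) //= /row_form; apply: eq_bigr => l _.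
rewrite /adjacency_tensor; case: ifPn => [lH|lNH].
  rewrite (bigD1 [set v in i :: l]) ?lH ?eqxx //= [X in _ + X]big1 ?addr0 // => e /andP[/andP[_ /eqP->]].
  by rewrite eqxx.
by rewrite scale0r big1 // => e /andP[eH /eqP le]; rewrite le eH in lNH.
Qed.

(** * Vertices and edges of the hypercycle *)

Lemma divn_rem_inj d a b s t : (s < d)%N -> (t < d)%N ->
  (a * d + s = b * d + t)%N -> a = b /\ s = t.
Proof.
by move=> sd td /(congr1 (edivn^~ d)) /=; rewrite !edivn_eq // => -[-> ->].
Qed.

Section Hypercycle.
Variable q : nat.
Local Notation n := (4 * q.+2)%N.
Implicit Types (e f : 'I_4) (v : 'I_n).

Definition cycle_edge e : {set 'I_n} := @hypercycle_edge 4 q.+3 e.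

(** The vertices form four blocks of [q.+2], which is k - 1. Block [e] is edge [e] without its last
    vertex, and that vertex opens the next block. *)
Definition block v : 'I_4 := Ordinal (etrans (ltn_divLR v 4 (ltn0Sn q.+1)) (ltn_ord v)).

Definition core v : bool := (q.+2 %| v)%N.

Lemma vertex_proof e (t : 'I_q.+2) : (e * q.+2 + t < n)%N.
Proof. by have := ltn_ord e; have := ltn_ord t; nia. Qed.

Definition vertex e t : 'I_n := Ordinal (vertex_proof e t).

Lemma block_vertex e t : block (vertex e t) = e.
Proof. by apply: val_inj; rewrite /= divnMDl // divn_small ?addn0. Qed.

Lemma core_vertex e t : core (vertex e t) = (t == ord0).
Proof.
by rewrite /core /dvdn /= modnMDl modn_small // -(inj_eq val_inj) /=.
Qed.

Lemma vertexP v : {et | v = vertex et.1 et.2}.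
Proof.
exists (block v, Ordinal (ltn_pmod v (ltn0Sn q.+1))).
by apply: val_inj; rewrite /= -divn_eq.
Qed.

Lemma big_vertex (R : Type) (idx : R) (op : Monoid.com_law idx) (F : 'I_n -> R) :
  \big[op/idx]_v F v = \big[op/idx]_e \big[op/idx]_(t < q.+2) F (vertex e t).
Proof.
rewrite pair_bigA /= (reindex (fun et : 'I_4 * 'I_q.+2 => vertex et.1 et.2)) //=.
exists (fun v => (block v, Ordinal (ltn_pmod v (ltn0Sn q.+1)))) => [[e t] _|v _].
  by congr pair; rewrite ?block_vertex //; apply: val_inj; rewrite /= modnMDl modn_small.
by apply: val_inj; rewrite /= -divn_eq.
Qed.

(** Offsets below k - 1 stay in block [e]; the last one reaches the core vertex of the next block.
    Addition in ['I_4] handles the wrap-around. *)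
Lemma mem_cycle_edge v e :
  (v \in cycle_edge e) = (block v == e) || core v && (block v == e + 1).
Proof.
have [[f t] /= ->] := vertexP v; rewrite block_vertex core_vertex inE.
have valE : val (e + 1)%R = (e.+1 %% 4)%N by rewrite /= modnDmr addn1.
have eltn := ltn_ord e; have fltn := ltn_ord f; have tltn := ltn_ord t.
rewrite -!(inj_eq val_inj) valE /=.
have vtE : (f * q.+2 + t < 4 * q.+2)%N by nia.
apply/existsP/idP => [[s]|].
  have := ltn_ord s; rewrite ltnS leq_eqVlt => /predU1P[->|s_lt] /eqP.
    rewrite modn_small // -mulSnr -muln_modl -[RHS]addn0 => /divn_rem_inj[]// -> ->.
    by rewrite !eqxx orbT.
  rewrite (modn_small vtE) [X in _ = X -> _]modn_small; last by nia.
  by move=> /divn_rem_inj[]// ->; rewrite eqxx.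
case/orP=> [/eqP fe|/andP[/eqP t0 /eqP fe]].
  exists (Ordinal (ltnW tltn : (t < q.+3)%N)); rewrite /= fe //.
by exists ord_max; rewrite /= t0 fe addn0 -mulSnr muln_modl modn_mod.
Qed.

Lemma card_cycle_edge e : #|cycle_edge e| = q.+3.
Proof. by apply: (@hypercycle_uniform 4 q.+3 isT isT); apply/imsetP; exists e. Qed.

Lemma cycle_edge_inj : injective cycle_edge.
Proof.
(* The vertex of offset 1 is not a core vertex, so it determines its edge. *)
move=> e f /setP/(_ (vertex e 1)); rewrite !mem_cycle_edge block_vertex.
have -> : core (vertex e 1) = false by rewrite core_vertex.
by rewrite eqxx /= orbF => /esym/eqP.
Qed.

Lemma row_form_hypercycle (C : numClosedFieldType) v :
  row_form (adjacency_tensor C q.+3 (hypercycle 4 q.+3)) v =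
    'X_[star v (cycle_edge (block v))]
    + (if core v then 'X_[star v (cycle_edge (block v - 1))] else 0).
Proof.
rewrite row_form_adjacency; last exact: (@hypercycle_uniform 4 q.+3 isT isT).
rewrite big_mkcondr big_imset /=; last by move=> e f _ _; apply: cycle_edge_inj.
rewrite -big_mkcond /=.
under eq_bigl do rewrite mem_cycle_edge.
rewrite (bigD1 (block v)) ?eqxx //=; congr (_ + _).
case: (core v) => /=; last first.
  by rewrite big_pred0 // => e; rewrite orbF eq_sym andbN.
rewrite (big_pred1 (block v - 1)) // => e.
have [->|eb] := eqVneq e (block v); rewrite ?andbF ?andbT /=.
  by rewrite -subr_eq0 opprB addrC subrK oner_eq0.
by rewrite [RHS]eq_sym subr_eq.
Qed.

End Hypercycle.

(** * Expansion of the trace over rootings *)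

Section Expansion.
Variables (C : numClosedFieldType) (q : nat).
Local Notation n := (4 * q.+2)%N.
Local Notation E := (@cycle_edge q).
Local Notation T := (adjacency_tensor C q.+3 (hypercycle 4 q.+3)).
Implicit Types (e f : 'I_4) (v : 'I_n) (j r : 'I_n -> nat).

(* Out of the j v times that v is a root, r v use the edge (block v) and, when
   v lies on two edges, the others use the previous edge. *)
Definition cycle_roots j r v e : nat :=
  ((e == block v) * r v + (e == block v - 1)%R * (j v - r v))%N.

(** The coefficient in the binomial expansion of [row_form T v ^+ j v]; the Boolean rules out a
    second edge at a vertex of degree one. *)
Definition root_choices j r v : nat :=
  ('C(j v, r v) * (core v || (r v == j v)))%N.

(** The sum is extended to a bound [d] common to all vertices, where the binomial coefficients
    vanish, so that the product over [v] distributes over functions [r]. *)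
Lemma exp_row_form v (j d : nat) : (j <= d)%N ->
  row_form T v ^+ j = \sum_(r < d.+1) ('C(j, r) * (core v || (r == j :> nat)))%:R *:
     'X_[star v (E (block v)) *+ r
         + star v (E (block v - 1)) *+ (j - r)].
Proof.
move=> jd; rewrite row_form_hypercycle addrC exprDn.
rewrite (big_ord_widen d.+1 (fun i => (_ ^+ (j - i) * _ ^+ i) *+ 'C(j, i))) ?ltnS //.
rewrite big_mkcond /=; apply: eq_bigr => r _.
have [rj|jr] := ltnP r j.+1; last by rewrite bin_small // mul0n scale0r.
rewrite natrM -scalerA scaler_nat; congr (_ *+ _).
rewrite mpolyXD !mpolyXn mulrC; case: (core v) => /=; first by rewrite scale1r mpolyXn.
have [->|rj'] := eqVneq (r : nat) j; first by rewrite subnn expr0 mulm0n mpolyX0 scale1r.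
by rewrite scale0r expr0n subn_eq0 leqNgt ltn_neqAle rj' -ltnS rj mulr0.
Qed.

Lemma rooting_cycle_roots j r :
  rooting E (cycle_roots j r) =
    (\sum_v (star v (E (block v)) *+ r v
         + star v (E (block v - 1)%R) *+ (j v - r v)))%MM.
Proof.
apply: eq_bigr => v _.
have b1 : (block v - 1 == block v) = false.
  by rewrite -subr_eq0 addrAC subrr sub0r oppr_eq0 oner_eq0.
rewrite (bigD1 (block v)) //= (bigD1 (block v - 1)) ?b1 //= big1.
  by rewrite addm0 /cycle_roots !eqxx eq_sym b1 !mul0n !mul1n addn0 add0n.
move=> e /andP[/negPf eb /negPf eb1]; rewrite /cycle_roots eb eb1 !mul0n.
by rewrite mulm0n.
Qed.

Lemma tensor_trace_expand d :
  tensor_trace T d = \sum_(j : {ffun 'I_n -> 'I_d.+1} | (\sum_v j v)%N == d)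
    \sum_(r : {ffun 'I_n -> 'I_d.+1})
      (\prod_v ((root_choices (fun u => j u) (fun u => r u) v)%:R
                / ((j v * q.+2)`!)%:R)) *
      (q.+2%:R ^+ n.-1 * \sum_a trails C (rooting E
          (cycle_roots (fun u => j u) (fun u => r u))) (d * q.+2) a a).
Proof.
rewrite /tensor_trace raddf_sum mulr_sumr; apply: eq_bigr => j _ /=.
rewrite mcoeff0_trace_operator.
rewrite (eq_bigr (fun v => \sum_(r < d.+1)
    (('C(j v, r) * (core v || (r == j v :> nat)))%:R / ((j v * q.+2)`!)%:R : C) *:
     'X_[star v (E (block v)) *+ r
         + star v (E (block v - 1)) *+ (j v - r)])) => [|v _]; last first.
  rewrite (@exp_row_form _ _ d) ?leq_ord // scaler_sumr; apply: eq_bigr => r _.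
  by rewrite scalerA mulrC.
rewrite bigA_distr_bigA /= apolar_suml mulr_sumr; apply: eq_bigr => r _.
rewrite scaler_prod apolarZl mulrCA natrX; congr (_ * (_ * _)).
rewrite -(big_morph _ (@mpolyXD _ _) (@mpolyX0 _ _)) -rooting_cycle_roots.
by rewrite /mxtrace apolar_sumr.
Qed.

End Expansion.

(** * Balanced rootings *)

Section Configurations.
Variable q : nat.
Local Notation n := (4 * q.+2)%N.
Local Notation E := (@cycle_edge q).
Implicit Types (e f : 'I_4) (v : 'I_n) (j r : 'I_n -> nat) (s a : 'I_4 -> nat).

Lemma addr1_neq e : (e + 1 == e) = false.
Proof. by rewrite -subr_eq0 addrAC subrr add0r oner_eq0. Qed.

Lemma subr1_neq e : (e - 1 == e) = false.
Proof. by rewrite -subr_eq0 addrAC subrr sub0r oppr_eq0 oner_eq0. Qed.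

Lemma big_cycle_edge (V : nmodType) e (F : 'I_n -> V) :
  \sum_(v in E e) F v = \sum_t F (vertex e t) + F (vertex (e + 1) ord0).
Proof.
rewrite big_mkcond big_vertex (bigD1 e) //= (bigD1 (e + 1)) ?addr1_neq //=.
congr (_ + _).
  by apply: eq_bigr => t _; rewrite mem_cycle_edge block_vertex eqxx.
rewrite [X in _ + X]big1 ?addr0 => [|f /andP[/negPf fe /negPf fe1]]; last first.
  by apply: big1 => t _; rewrite mem_cycle_edge block_vertex fe fe1 andbF.
rewrite (bigD1 ord0) //= mem_cycle_edge core_vertex block_vertex !eqxx orbT.
rewrite big1 ?addr0 // => t /negPf t0.
by rewrite mem_cycle_edge core_vertex block_vertex t0 addr1_neq.
Qed.

Lemma sum_edges_at v (F : 'I_4 -> nat) :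
  (\sum_(e | v \in E e) F e = F (block v) + core v * F (block v - 1)%R)%N.
Proof.
rewrite (bigD1 (block v)) ?mem_cycle_edge ?eqxx //=; congr (_ + _)%N.
under eq_bigl do rewrite mem_cycle_edge.
case: (core v) => /=; last by rewrite big_pred0 // => e; rewrite orbF eq_sym andbN.
rewrite mul1n (big_pred1 (block v - 1)) // => e.
have [->|eb] := eqVneq e (block v); rewrite ?andbF ?andbT /=.
  by rewrite eq_sym subr1_neq.
by rewrite [RHS]eq_sym subr_eq.
Qed.

Section Valid.
Variables j r : 'I_n -> nat.
Hypothesis r_le : forall v, (r v <= j v)%N.
Hypothesis r_eq : forall v, ~~ core v -> r v = j v.

Lemma cycle_roots_supp v e : v \notin E e -> cycle_roots j r v e = 0%N.
Proof.
rewrite mem_cycle_edge negb_or negb_and /cycle_roots => /andP[eb].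
rewrite [e == block v]eq_sym (negPf eb) mul0n => /orP[/r_eq->|]; first by rewrite subnn muln0.
by rewrite [e == _ - _]eq_sym subr_eq => /negPf->.
Qed.

Lemma rootdeg_cycle_roots v : rootdeg (cycle_roots j r) v = j v.
Proof.
rewrite /rootdeg /cycle_roots (bigD1 (block v)) //= (bigD1 (block v - 1)) ?subr1_neq //=.
rewrite big1 => [|e /andP[/negPf-> /negPf->]] //.
by rewrite !eqxx eq_sym !subr1_neq !mul1n !mul0n addn0 add0n addn0 subnKC.
Qed.

Lemma sum_cycle_roots e :
  (\sum_v cycle_roots j r v e =
   \sum_t r (vertex e t) + (j (vertex (e + 1)%R ord0) - r (vertex (e + 1)%R ord0)))%N.
Proof.
rewrite (bigID (mem (E e))) /= [X in (_ + X)%N]big1 ?addn0 => [|v /cycle_roots_supp] //.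
rewrite -[LHS]/(\sum_(v in E e) cycle_roots j r v e)%R big_cycle_edge; congr (_ + _)%N.
  apply: eq_bigr => t _; rewrite /cycle_roots block_vertex eqxx eq_sym subr1_neq.
  by rewrite mul0n addn0 mul1n.
by rewrite /cycle_roots block_vertex addrK eqxx eq_sym addr1_neq mul1n.
Qed.

End Valid.

Definition config_deg s v : nat := (s (block v) + core v * s (block v - 1)%R)%N.
Definition config_roots s a v : nat := if core v then a (block v) else s (block v).

(** The equation says that the two core vertices of [e] root it [2 * s e] times together. With the
    bound, it makes [a e - s e] independent of [e]. *)
Definition admissible s a := forall e, (a e <= s e + s (e - 1)%R)%N /\
  (a e + (s (e + 1)%R + s e - a (e + 1)%R) = 2 * s e)%N.

Lemma config_deg_vertex s e t :
  config_deg s (vertex e t) = (s e + (t == ord0) * s (e - 1)%R)%N.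
Proof. by rewrite /config_deg block_vertex core_vertex. Qed.

Lemma config_roots_vertex s a e t :
  config_roots s a (vertex e t) = if t == ord0 then a e else s e.
Proof. by rewrite /config_roots block_vertex core_vertex. Qed.

Section Admissible.
Variables s a : 'I_4 -> nat.
Hypothesis adm : admissible s a.
Local Notation roots := (cycle_roots (config_deg s) (config_roots s a)).

Lemma config_roots_le v : (config_roots s a v <= config_deg s v)%N.
Proof.
rewrite /config_roots /config_deg; case: (core v); last exact: leq_addr.
by rewrite mul1n; have [] := adm (block v).
Qed.

Lemma config_roots_eq v : ~~ core v -> config_roots s a v = config_deg s v.
Proof.
by rewrite /config_roots /config_deg => /negPf->; rewrite addn0.
Qed.

Lemma sum_config_roots e : (\sum_v roots v e = q.+3 * s e)%N.
Proof.
rewrite sum_cycle_roots; last exact: config_roots_eq.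
rewrite big_ord_recl config_roots_vertex eqxx.
rewrite (eq_bigr (fun=> s e)) => [|t _]; last by rewrite config_roots_vertex.
rewrite sum_nat_const card_ord config_deg_vertex config_roots_vertex eqxx mul1n addrK.
by have [_] := adm e; lia.
Qed.

Lemma config_balanced v : outdeg (rooting E roots) v = indeg (rooting E roots) v.
Proof.
have supp := cycle_roots_supp config_roots_eq.
have := indeg_rooting supp v.
rewrite (outdeg_rooting (@card_cycle_edge q) supp) rootdeg_cycle_roots; last first.
  exact: config_roots_le.
rewrite sum_edges_at !sum_config_roots /config_deg.
by case: (core v) => /=; lia.
Qed.

End Admissible.

(** Balance means that k times [j v] is the number of rootings of the edges at [v]. A vertex of
    degree one gives k times [s e] for its edge, which determines [j]; counting these rootings
    vertex by vertex then gives admissibility. *)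
Lemma balanced_config j r :
    (forall v, (r v <= j v)%N) -> (forall v, ~~ core v -> r v = j v) ->
    (forall v, outdeg (rooting E (cycle_roots j r)) v =
               indeg (rooting E (cycle_roots j r)) v) ->
  let s e := j (vertex e 1) in let a e := r (vertex e ord0) in
  [/\ j =1 config_deg s, r =1 config_roots s a, admissible s a &
      (\sum_v j v = q.+3 * \sum_e s e)%N].
Proof.
move=> r_le r_eq bal s a.
have supp := cycle_roots_supp r_eq.
have degE v : (q.+3 * j v = \sum_u cycle_roots j r u (block v)
    + core v * \sum_u cycle_roots j r u (block v - 1)%R)%N.
  have := rootdeg_balanced (@card_cycle_edge q) supp bal v.
  by rewrite rootdeg_cycle_roots // sum_edges_at.
have sE e : (\sum_u cycle_roots j r u e = q.+3 * s e)%N.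
  by rewrite degE block_vertex core_vertex addn0.
have jE : j =1 config_deg s.
  move=> v; apply/eqP; rewrite -(eqn_pmul2l (ltn0Sn q.+2)) degE !sE /config_deg.
  by apply/eqP; lia.
have rE : r =1 config_roots s a.
  move=> v; rewrite /config_roots; case: ifPn => [cv|/[dup] Ncv /r_eq->]; last first.
    by rewrite jE /config_deg (negPf Ncv) addn0.
  have [[e t] /= vE] := vertexP v; rewrite vE block_vertex /a.
  by move: cv; rewrite vE core_vertex => /eqP->.
split=> // [e|].
  split; first by have := r_le (vertex e ord0); rewrite jE config_deg_vertex mul1n.
  have := sE e; rewrite sum_cycle_roots // big_ord_recl.
  rewrite (eq_bigr (fun=> s e)) => [|t _]; last by rewrite rE config_roots_vertex.
  rewrite sum_nat_const card_ord jE config_deg_vertex eqxx mul1n addrK -/(a e) -/(a (e + 1)%R).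
  by lia.
rewrite big_distrr /=; under [RHS]eq_bigr do rewrite -sE.
rewrite exchange_big; apply: eq_bigr => v _.
by have := rootdeg_cycle_roots r_le v.
Qed.

End Configurations.

(** * Principal cofactors of cyclic tridiagonal matrices *)

Lemma det2E (R : comNzRingType) (g : nat -> nat -> R) :
  \det (\matrix_(i < 2, j < 2) g i j) = g 0%N 0%N * g 1%N 1%N - g 0%N 1%N * g 1%N 0%N.
Proof.
rewrite (expand_det_row _ ord0) !big_ord_recl big_ord0 /cofactor !det_mx11 !mxE /=.
by rewrite /bump /=; ring.
Qed.

(** Entries are given by a function on naturals, so that minors keep this shape after composition
    with [bump]. *)
Lemma det3E (R : comNzRingType) (g : nat -> nat -> R) :
  \det (\matrix_(i < 3, j < 3) g i j) =
    g 0%N 0%N * (g 1%N 1%N * g 2%N 2%N - g 1%N 2%N * g 2%N 1%N)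
    - g 0%N 1%N * (g 1%N 0%N * g 2%N 2%N - g 1%N 2%N * g 2%N 0%N)
    + g 0%N 2%N * (g 1%N 0%N * g 2%N 1%N - g 1%N 1%N * g 2%N 0%N).
Proof.
rewrite (expand_det_row _ ord0) !big_ord_recl big_ord0 /cofactor !mxE /=.
have E c : row' ord0 (col' c (\matrix_(i < 3, j < 3) g i j)) =
    \matrix_(i < 2, j < 2) g (bump 0 i) (bump c j).
  by apply/matrixP => i j; rewrite !mxE.
rewrite !E !(det2E (fun i j => g (bump 0 i) (bump _ j))) /= /bump /=; ring.
Qed.

Lemma det_row_delta4 (R : comNzRingType) (g : nat -> nat -> R) (e : 'I_4) :
  let h i j := g (bump e i) (bump e j) in
  \det (row_delta e (\matrix_(i < 4, j < 4) g i j)) =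
    \det (\matrix_(i < 3, j < 3) h i j).
Proof.
move=> h; rewrite (expand_det_row _ e) (bigD1 e) //= big1 => [|j /negPf je].
  rewrite addr0 !mxE !eqxx mul1r /cofactor -signr_odd addnn odd_double mul1r.
  congr determinant; apply/matrixP => i j; rewrite !mxE.
  by rewrite eq_sym (negPf (neq_lift _ _)).
by rewrite !mxE eqxx je mul0r.
Qed.

Definition cyclic_tridiag (R : comNzRingType) (D U L : 'I_4 -> R) : 'M[R]_4 :=
  \matrix_(e, f) ((e == f)%:R * D e - (f == e + 1)%:R * U e - (f == e - 1)%:R * L e).

(** Deleting [e] from the 4-cycle leaves the path [e + 1], [e + 2], [e + 3], so each principal
    cofactor is a tridiagonal determinant. *)
Lemma sum_det_cyclic_tridiag (R : comNzRingType) (D U L : 'I_4 -> R) :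
  \sum_e \det (row_delta e (cyclic_tridiag D U L)) =
  \sum_e (D (e + 1) * D (e + 2) * D (e + 3)
          - D (e + 1) * U (e + 2) * L (e + 3) - D (e + 3) * U (e + 1) * L (e + 2)).
Proof.
have [d DE] : exists d : nat -> R, forall e, D e = d (val e).
  by exists (D \o inord) => e; rewrite /= inord_val.
have [u UE] : exists u : nat -> R, forall e, U e = u (val e).
  by exists (U \o inord) => e; rewrite /= inord_val.
have [l LE] : exists l : nat -> R, forall e, L e = l (val e).
  by exists (L \o inord) => e; rewrite /= inord_val.
pose g (i j : nat) := (i == j)%:R * d i - (j == i.+1 %% 4)%N%:R * u i - (j == (i + 3) %% 4)%N%:R * l i.
have -> : cyclic_tridiag D U L = \matrix_(i < 4, j < 4) g i j.
  apply/matrixP => i j; rewrite !mxE /g -DE -UE -LE -!(inj_eq val_inj).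
  by rewrite /= modnDmr addn1.
under eq_bigr do rewrite det_row_delta4 (det3E (fun i j => g (bump _ i) (bump _ j))).
rewrite !big_ord_recl !big_ord0 !DE !UE !LE /bump /g /=.
by ring.
Qed.

(** * The contribution of one configuration *)

Section ConfigurationTerm.
Variables (C : numClosedFieldType) (q : nat) (s a : 'I_4 -> nat).
Local Notation n := (4 * q.+2)%N.
Local Notation E := (@cycle_edge q).
Local Notation roots := (cycle_roots (@config_deg q s) (config_roots s a)).
Hypothesis adm : admissible s a.

Definition core_deg (e : 'I_4) : nat := (s e + s (e - 1)%R)%N.
Definition up_share (e : 'I_4) : C := (a e)%:R / (core_deg e)%:R.
Definition down_share (e : 'I_4) : C := (core_deg e - a e)%:R / (core_deg e)%:R.

(** The [q.+1] vertices of degree one in [e] affect only the diagonal; its two core vertices link it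
    to [e - 1] and [e + 1]. *)
Lemma config_edge_laplacian :
  edge_laplacian C q.+2 E roots = cyclic_tridiag
    (fun e => q.+3%:R - (q.+1 * (0 < s e))%:R - up_share e - down_share (e + 1))
    (fun e => up_share (e + 1)) down_share.
Proof.
apply/matrixP => e f; rewrite !mxE.
rewrite (eq_bigr (fun v => if v \in E e then root_share C roots v f else 0))
  => [|v _]; last by rewrite !mxE; case: ifP; rewrite ?mul1r ?mul0r.
rewrite -big_mkcond big_cycle_edge big_ord_recl !mxE.
rewrite !rootdeg_cycle_roots; try exact: config_roots_le.
rewrite !config_deg_vertex !eqxx !mul1n !addrK /cycle_roots !block_vertex.
rewrite !config_deg_vertex !config_roots_vertex !eqxx !mul1n addrK.
rewrite -/(core_deg e) (_ : (s (e + 1)%R + s e)%N = core_deg (e + 1)); last first.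
  by rewrite /core_deg addrK.
rewrite (eq_bigr (fun=> (f == e)%:R * (0 < s e)%N%:R)) => [|t _]; last first.
  rewrite mxE rootdeg_cycle_roots; last exact: config_roots_le.
  rewrite /cycle_roots !block_vertex !config_deg_vertex !config_roots_vertex /=.
  rewrite !addn0 subnn muln0 addn0 natrM -mulrA; congr (_ * _).
  have [->|se_gt0] := posnP (s e); first by rewrite invr0 mulr0.
  by rewrite divff // pnatr_eq0 -lt0n.
rewrite /up_share /down_share; move: (core_deg e) (core_deg (e + 1)) => c c'.
rewrite sumr_const card_ord -[_ *+ q.+1]mulr_natr -[_ *+ (e == f)]mulr_natr.
rewrite [(q.+1 * _)%:R]natrM [e == f]eq_sym !natrD !(natrM _ (_ == _)).
by ring.
Qed.

Definition config_weight : nat :=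
  (\prod_e ('C(core_deg e, a e) *
    ((q.+2 + (0 < s e)) ^ q.+1 * (q.+2 + (0 < core_deg e)))))%N.

(** The factorials of the BEST theorem cancel the denominators of the trace. The factor
    [q.+3%:R ^+ 4] is the [c ^+ m] of the passage to four edges. *)
Lemma config_term d : (\sum_v @config_deg q s v = d)%N -> (0 < d)%N ->
  (\prod_v ((root_choices (@config_deg q s) (config_roots s a) v)%:R
            / ((config_deg s v * q.+2)`!)%:R)) *
  (q.+2%:R ^+ n.-1 * \sum_u trails C (rooting E roots) (d * q.+2) u u) * q.+3%:R ^+ 4
  = config_weight%:R * \sum_e \det (row_delta e (edge_laplacian C q.+2 E roots)).
Proof.
move=> sum_deg d_gt0.
have supp := cycle_roots_supp (@config_roots_eq q s a).
have degE v : rootdeg roots v = config_deg s v.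
  by rewrite rootdeg_cycle_roots //; apply: config_roots_le.
have sum_rootdeg : (\sum_v rootdeg roots v = d)%N.
  by rewrite -sum_deg; apply: eq_bigr => v _.
have mdegE := mdeg_rooting (@card_cycle_edge q) supp.
rewrite sum_rootdeg in mdegE; rewrite -mdegE -mulrA.
rewrite (sum_trails_rooting C _ (@card_cycle_edge q) supp (config_balanced adm)) //; last first.
  by rewrite sum_rootdeg.
rewrite !mulrA; congr (_ * _); rewrite -!big_split /= /config_weight natr_prod big_vertex.
apply: eq_bigr => e _; rewrite big_ord_recl.
rewrite (eq_bigr (fun=> (q.+2 + (0 < s e))%N%:R)) => [|t _]; last first.
  rewrite /root_choices !degE config_deg_vertex config_roots_vertex /= addn0 binn eqxx orbT.
  by rewrite mul1r mulVf ?mul1r // pnatr_eq0 -lt0n fact_gt0.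
rewrite prodr_const card_ord /root_choices !degE config_deg_vertex config_roots_vertex.
rewrite core_vertex eqxx mul1n muln1 -/(core_deg e) divfK ?pnatr_eq0 -?lt0n ?fact_gt0 //.
by rewrite !natrM natrX /= mulrAC mulrA.
Qed.

End ConfigurationTerm.

(** * Enumeration of the configurations *)

Section Enumeration.
Variable q : nat.
Local Notation n := (4 * q.+2)%N.
Local Notation E := (@cycle_edge q).

Definition root_term (C : numClosedFieldType) d (j r : 'I_n -> nat) : C :=
  (\prod_v ((root_choices j r v)%:R / ((j v * q.+2)`!)%:R)) *
  (q.+2%:R ^+ n.-1 *
     \sum_a trails C (rooting E (cycle_roots j r)) (d * q.+2) a a).

Lemma eq_root_term (C : numClosedFieldType) d (j r j' r' : 'I_n -> nat) :
  j =1 j' -> r =1 r' -> root_term C d j r = root_term C d j' r'.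
Proof.
move=> jj' rr'; rewrite /root_term; congr (_ * (_ * _)).
  by apply: eq_bigr => v _; rewrite /root_choices jj' rr'.
apply: eq_bigr => a _; congr trails; apply: eq_bigr => v _.
by apply: eq_bigr => e _; rewrite /cycle_roots jj' rr'.
Qed.

Lemma root_term_neq0 (C : numClosedFieldType) d j r :
    root_term C d j r != 0 ->
  [/\ forall v, (r v <= j v)%N, forall v, ~~ core v -> r v = j v &
      forall v, outdeg (rooting E (cycle_roots j r)) v
                = indeg (rooting E (cycle_roots j r)) v].
Proof.
rewrite !mulf_eq0 !negb_or => /andP[/prodf_neq0 choices_neq0 /andP[_ trails_neq0]].
have choice v : (r v <= j v)%N && (core v || (r v == j v)).
  have := choices_neq0 v isT; rewrite mulf_eq0 negb_or pnatr_eq0 => /andP[].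
  by rewrite muln_eq0 negb_or -lt0n bin_gt0 eqb0 negbK.
split=> [v|v /negPf Ncv|v]; first by have /andP[] := choice v.
  by have := choice v; rewrite Ncv => /andP[_ /eqP].
have [a ta|t0] := pickP (fun a => trails C (rooting E (cycle_roots j r)) (d * q.+2) a a != 0).
  by have /addIn := trails_unbalanced ta v.
by case/eqP: trails_neq0; apply: big1 => a _; have /negbFE/eqP := t0 a.
Qed.

Lemma sum_config_deg s : (\sum_v @config_deg q s v = q.+3 * \sum_e s e)%N.
Proof.
rewrite big_vertex mulSn mulnC [in RHS]big_distrl /=.
have -> : (\sum_e s e = \sum_e s (e - 1)%R)%N.
  by rewrite (reindex_inj (addIr (-1))).
rewrite -big_split; apply: eq_bigr => e _ /=; rewrite big_ord_recl config_deg_vertex.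
rewrite (eq_bigr (fun=> s e)) => [|t _]; last by rewrite config_deg_vertex addn0.
by rewrite sum_nat_const card_ord eqxx mul1n addnAC -mulSn addnC mulnC.
Qed.

End Enumeration.

(* A configuration is [:: s0; s1; s2; s3; a0]; the other values of a follow, as
   a e - s e does not depend on e. *)
Definition seq_s (c : seq nat) (e : 'I_4) : nat := nth 0%N c e.
Definition seq_a (c : seq nat) (e : 'I_4) : nat :=
  (nth 0 c e + nth 0 c 4 - nth 0 c 0)%N.

(** The bounds on [a e = s e + a 0 - s 0], written without subtraction; [(i + 3) %% 4] is the index
    of the previous edge. *)
Definition seq_admissible (c : seq nat) : bool :=
  (nth 0 c 0 + nth 0 c 1 + nth 0 c 2 + nth 0 c 3 == 4)%N &&
  all (fun i => (nth 0 c 0 <= nth 0 c i + nth 0 c 4)%N &&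
    (nth 0 c 4 <= nth 0 c 0 + nth 0 c ((i + 3) %% 4))%N) (iota 0 4).

(** The range below 9 loses nothing: each [s] entry is at most 4, and so is [a0 <= s0 + s3]. *)
Definition configs : seq (seq nat) :=
  [seq c <- iter 5 (fun l => [seq x :: c | x <- iota 0 9, c <- l]) [:: [::]]
         | seq_admissible c].

Lemma mem_iter_cons (b m : nat) (c : seq nat) :
  (c \in iter m (fun l => [seq x :: c | x <- iota 0 b, c <- l]) [:: [::]]) =
  (size c == m) && all (fun x => (x < b)%N) c.
Proof.
elim: m c => [|m IHm] c /=; first by rewrite inE; case: c.
case: c => [|x c]; first by apply/negbTE/negP => /allpairsP[[? ?] []].
rewrite /= eqSS -andbCA -IHm; apply/allpairsP/andP => [[[y c'] /= [yb c'm [-> ->]]]|].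
  by rewrite mem_iota in yb.
by move=> [xb cm]; exists (x, c); rewrite mem_iota.
Qed.

Lemma uniq_configs : uniq configs.
Proof. by vm_compute. Qed.

Lemma mem_configs c : (c \in configs) = (size c == 5) && seq_admissible c.
Proof.
rewrite mem_filter mem_iter_cons andbC -andbA; case: eqP => //= c5.
rewrite andbC; case adm: (seq_admissible c) => //=.
case: c c5 adm => [|s0 [|s1 [|s2 [|s3 [|a0 [|]]]]]] //= _.
by rewrite /seq_admissible /=; lia.
Qed.

Lemma seq_admissibleP c : seq_admissible c ->
  admissible (seq_s c) (seq_a c) /\ (\sum_e seq_s c e = 4)%N.
Proof.
case/andP=> [/eqP sum4 /= adm]; split; last by rewrite !big_ord_recl big_ord0 addn0 !addnA.
have adm_nat i : (i < 4)%N -> (nth 0 c 0 <= nth 0 c i + nth 0 c 4)%N /\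
    (nth 0 c 4 <= nth 0 c 0 + nth 0 c ((i + 3) %% 4))%N.
  by move: adm; case: i => [|[|[|[|]]]] //= => /and5P[/andP[? ?] /andP[? ?] /andP[? ?] /andP[? ?] _].
move=> e; have [lb ub] := adm_nat _ (ltn_ord e).
have [lb' ub'] := adm_nat _ (ltn_ord (e + 1)).
have prevE : (((e + 1)%R + 3) %% 4 = e)%N by rewrite -[in RHS](addrK 1 e).
rewrite prevE in ub'.
have -> : seq_s c (e - 1) = nth 0%N c ((e + 3) %% 4) by [].
by rewrite /seq_a /seq_s; lia.
Qed.


Lemma big_support (I : finType) (V : nmodType) (l : seq I) (P : pred I) (F : I -> V) :
    uniq l -> {subset l <= P} -> (forall i, P i -> F i != 0 -> i \in l) ->
  \sum_(i | P i) F i = \sum_(i <- l) F i.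
Proof.
move=> l_uniq lP suppl; rewrite (big_uniq _ l_uniq) [LHS](bigID (fun i => i \in l)) /=.
rewrite [X in _ + X]big1 ?addr0 => [|i /andP[Pi]]; last first.
  by apply: contraNeq; apply: suppl.
by apply: eq_bigl => i; apply: andb_idl; apply: lP.
Qed.

(** * Reduction of the trace to the listed configurations *)

Section SumOverConfigurations.
Variables (C : numClosedFieldType) (q : nat).
Local Notation n := (4 * q.+2)%N.
Local Notation d := (4 * q.+3)%N.

Definition config_pair (c : seq nat) :
    {ffun 'I_n -> 'I_d.+1} * {ffun 'I_n -> 'I_d.+1} :=
  ([ffun v => inord (config_deg (seq_s c) v)],
   [ffun v => inord (config_roots (seq_s c) (seq_a c) v)]).

Lemma sum_seq_config_deg c : seq_admissible c ->
  (\sum_v @config_deg q (seq_s c) v = d)%N.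
Proof. by case/seq_admissibleP => _ sum4; rewrite sum_config_deg sum4 mulnC. Qed.

Lemma config_pairE c : seq_admissible c ->
  (fun v => (config_pair c).1 v : nat) =1 @config_deg q (seq_s c) /\
  (fun v => (config_pair c).2 v : nat) =1 @config_roots q (seq_s c) (seq_a c).
Proof.
move=> adm; have deg_le v : (@config_deg q (seq_s c) v <= d)%N.
  by rewrite -(sum_seq_config_deg adm) (bigD1 v) //= leq_addr.
have [/config_roots_le roots_le _] := seq_admissibleP adm.
split=> v; rewrite ffunE inordK ?ltnS //.
exact: leq_trans (roots_le _ v) (deg_le v).
Qed.

Lemma config_pair_inj : {in configs &, injective config_pair}.
Proof.
move=> c c'; rewrite !mem_configs => /andP[/eqP sc adm_c] /andP[/eqP sc' adm_c'] cc'.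
have [degE rootsE] := config_pairE adm_c; have [degE' rootsE'] := config_pairE adm_c'.
have sE e : seq_s c e = seq_s c' e.
  by have := degE (vertex e 1); rewrite cc' degE' !config_deg_vertex !addn0.
have aE : seq_a c 0 = seq_a c' 0.
  by have := rootsE (vertex 0 ord0); rewrite cc' rootsE' !config_roots_vertex.
move: sE aE; case: c sc {adm_c cc' degE rootsE} => [|s0 [|s1 [|s2 [|s3 [|a0 [|]]]]]] //= _.
case: c' sc' {adm_c' degE' rootsE'} => [|s0' [|s1' [|s2' [|s3' [|a0' [|]]]]]] //= _ sE.
have := sE 0; have := sE 1; have := sE 2; have := sE 3; rewrite /seq_s /seq_a /=.
by move=> -> -> -> ->; rewrite !addKn => ->.
Qed.

(** A nonzero term forces a balanced rooting, hence by [balanced_config] an admissible pair [s],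
    [a], which five numbers encode. *)
Lemma tensor_trace_configs :
  tensor_trace (adjacency_tensor C q.+3 (hypercycle 4 q.+3)) d =
  \sum_(c <- configs) root_term C d (@config_deg q (seq_s c))
                                    (@config_roots q (seq_s c) (seq_a c)).
Proof.
rewrite tensor_trace_expand pair_big_dep /=.
pose F (p : {ffun 'I_n -> 'I_d.+1} * {ffun 'I_n -> 'I_d.+1}) :=
  root_term C d (fun v => p.1 v) (fun v => p.2 v).
rewrite (eq_bigr F) // (eq_bigl
  (fun p : {ffun 'I_n -> 'I_d.+1} * {ffun 'I_n -> 'I_d.+1} => (\sum_v p.1 v)%N == d)) => [|p]; last first.
  by rewrite andbT.
rewrite (@big_support _ _ (map config_pair configs)).
- rewrite big_map big_seq [RHS]big_seq; apply: eq_bigr => c.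
  rewrite mem_configs => /andP[_ adm].
  by have [degE rootsE] := config_pairE adm; apply: eq_root_term.
- by rewrite (map_inj_in_uniq config_pair_inj) uniq_configs.
- move=> p /mapP[c]; rewrite mem_configs => /andP[_ adm] ->.
  apply/eqP/(etrans _ (sum_seq_config_deg adm)); apply: eq_bigr => v _.
  by have [<- _] := config_pairE adm.
move=> p /eqP sum_j /root_term_neq0[r_le r_eq bal].
pose s e : nat := p.1 (vertex e 1); pose a e : nat := p.2 (vertex e ord0).
have [jE rE adm sumE] : [/\ (fun v => p.1 v : nat) =1 config_deg s,
    (fun v => p.2 v : nat) =1 config_roots s a, admissible s a &
    (\sum_v p.1 v = q.+3 * \sum_e s e)%N] := balanced_config r_le r_eq bal.
have sum4 : (\sum_e s e = 4)%N.
  apply/eqP; rewrite -(eqn_pmul2l (ltn0Sn q.+2)); apply/eqP.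
  exact: etrans (esym sumE) (etrans sum_j (mulnC _ _)).
have step e : (a e + s (e + 1)%R = s e + a (e + 1)%R)%N.
  have [_] := adm e; have [] := adm (e + 1); rewrite addrK; lia.
(* The relation [step] is iterated along the cycle from edge 0. *)
have shift e : (a e + s 0%R = s e + a 0%R)%N.
  have := step 0; have := step 1; have := step 2.
  have -> : 2 + 1 = 3 :> 'I_4 by apply: val_inj.
  have -> : 1 + 1 = 2 :> 'I_4 by apply: val_inj.
  rewrite add0r.
  have: [|| e == 0, e == 1, e == 2 | e == 3] by case: e => [[|[|[|[|]]]]].
  by case/or4P => /eqP->; lia.
pose c := [:: s 0; s 1; s 2; s 3; a 0].
have sE e : seq_s c e = s e.
  have: [|| e == 0, e == 1, e == 2 | e == 3] by case: e => [[|[|[|[|]]]]].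
  by case/or4P => /eqP->.
have aE e : seq_a c e = a e.
  rewrite /seq_a -[nth 0%N c e]/(seq_s c e) sE -[nth 0%N c 4]/(a 0).
  by rewrite -[nth 0%N c 0]/(s 0) -shift addnK.
have adm_c : seq_admissible c.
  apply/andP; split; first by rewrite -sum4 !big_ord_recl big_ord0 -!sE addn0 !addnA.
  apply/allP => i; rewrite mem_iota => /= i_lt4; pose e : 'I_4 := Ordinal i_lt4.
  rewrite -[nth 0%N c i]/(seq_s c e) -[nth 0%N c (_ %% _)]/(seq_s c (e - 1)) !sE.
  by have := shift e; have [+ _] := adm e; rewrite /c /=; lia.
have [degE rootsE] := config_pairE adm_c.
apply/mapP; exists c; first by rewrite mem_configs adm_c.
rewrite [LHS]surjective_pairing; congr pair; apply/ffunP => v; apply: val_inj; rewrite /=.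
  by rewrite degE jE /config_deg !sE.
by rewrite rootsE rE /config_roots sE aE.
Qed.

End SumOverConfigurations.

(** * Evaluation of the 37 configurations *)

Ltac eval_nat t := let v := eval vm_compute in t in change t with v.

Ltac eval_config :=
  repeat match goal with
  | |- context [core_deg ?s ?e] => eval_nat (core_deg s e)
  | |- context [seq_s ?c ?e] => eval_nat (seq_s c e)
  | |- context [seq_a ?c ?e] => eval_nat (seq_a c e)
  | |- context [(?x - ?y)%N] => eval_nat (x - y)%N
  | |- context [binomial ?x ?y] => eval_nat (binomial x y)
  | |- context [nat_of_bool (leq ?x ?y)] => eval_nat (nat_of_bool (leq x y))
  end.

(** The appended entry is [a 0 = s 0], which makes the shift zero. *)
Definition rotations (s : seq nat) (m : nat) : seq (seq nat * nat) :=
  [seq (rcons (rot i s) (nth 0 (rot i s) 0), m) | i <- iota 0 4]%N.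

(* The second component is the coefficient of the corresponding term of the
   trace. The shift a e - s e vanishes except for s = (1, 1, 1, 1). *)
Definition config_table : seq (seq nat * nat) :=
  (rotations [:: 4; 0; 0; 0] 1
   ++ rotations [:: 3; 1; 0; 0] 4 ++ rotations [:: 2; 2; 0; 0] 6
   ++ rotations [:: 1; 3; 0; 0] 4
   ++ rotations [:: 2; 1; 1; 0] 4 ++ rotations [:: 1; 2; 1; 0] 8
   ++ rotations [:: 1; 1; 2; 0] 4
   ++ [:: ([:: 1; 1; 1; 1; 0], 4); ([:: 1; 1; 1; 1; 1], 32); ([:: 1; 1; 1; 1; 2], 4)]
   ++ rotations [:: 3; 0; 1; 0] 0
   ++ [:: ([:: 2; 0; 2; 0; 2], 0); ([:: 0; 2; 0; 2; 0], 0)])%N.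

Lemma perm_configs : perm_eq configs (map fst config_table).
Proof. by vm_compute. Qed.

(** An edge that is never rooted replaces a factor [Y] by [X]. The coefficient is 0 when only two
    opposite edges are rooted: they are disjoint, so no trail uses both. *)
Lemma root_term_table (C : numClosedFieldType) q (p : seq nat * nat) :
  let K : C := q.+3%:R in let X : C := q.+2%:R ^+ q.+1 in let Y := K ^+ q.+1 in
  p \in config_table ->
  root_term C (4 * q.+3) (@config_deg q (seq_s p.1)) (@config_roots q (seq_s p.1) (seq_a p.1))
    = p.2%:R * nth 0 [:: Y ^+ 4; Y ^+ 3 * K * X; Y ^+ 2 * K * (X ^+ 2 * (K - 1));
                         Y * K * (X ^+ 3 * (K - 1) ^+ 2)] (count (pred1 0%N) (take 4 p.1)).
Proof.
move=> K X Y p_in.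
have adm : seq_admissible p.1.
  have : p.1 \in configs by rewrite (perm_mem perm_configs) map_f.
  by rewrite mem_configs => /andP[].
have K_neq0 : K != 0 by rewrite pnatr_eq0.
have [sadm _] := seq_admissibleP adm.
apply: (mulIf (expf_neq0 4 K_neq0)).
rewrite (config_term _ sadm) ?sum_seq_config_deg // config_edge_laplacian //.
rewrite sum_det_cyclic_tridiag /config_weight /up_share /down_share {sadm adm}.
have hK2 : q.+2%:R = K - 1 by rewrite /K; ring.
have hK1 : q.+1%:R = K - 2 by rewrite /K; ring.
rewrite !big_ord_recl !big_ord0.
(* The powers are made opaque, so that [field] sees rational functions of [K], [X] and [Y]. *)
have hK : K = q.+3%:R by []; have hX : X = q.+2%:R ^+ q.+1 by [].
have hY : Y = q.+3%:R ^+ q.+1 by [].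
clearbody X Y K; move: p_in.
let t := eval vm_compute in config_table in rewrite (_ : config_table = t) //.
rewrite !inE.
repeat (case/orP; [move=> /eqP-> /= |]); try move=> /eqP-> /=.
all: eval_config.
all: rewrite !(addn1, addn0, muln1, muln0, natrM, natrX) -?hX -?hY -?hK ?hK2 ?hK1.
all: rewrite ?(mulr0n, mul0r).
all: try by field; rewrite ?pnatr_eq0.
Qed.

Lemma sum_config_table (C : numClosedFieldType) (K X Y : C) :
  \sum_(p <- config_table) p.2%:R *
     nth 0 [:: Y ^+ 4; Y ^+ 3 * K * X; Y ^+ 2 * K * (X ^+ 2 * (K - 1));
               Y * K * (X ^+ 3 * (K - 1) ^+ 2)] (count (pred1 0%N) (take 4 p.1))
  = 4 * (Y * K * (X ^+ 3 * (K - 1) ^+ 2)) + 56 * (Y ^+ 2 * K * (X ^+ 2 * (K - 1)))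
    + 64 * (Y ^+ 3 * K * X) + 40 * Y ^+ 4.
Proof.
let t := eval vm_compute in config_table in rewrite (_ : config_table = t) //.
by rewrite !big_cons big_nil /=; ring.
Qed.

Theorem theorem3p4 (C : numClosedFieldType) (k : nat) (hk : (3 <= k)%N) :
  tensor_trace (adjacency_tensor C k (hypercycle 4 k)) (4 * k)%N =
    (4 * k ^ (k - 1) * (k - 1) ^ (3 * k - 4)
     + 56 * k ^ (2 * k - 3) * (k - 1) ^ (2 * k - 3)
     + 64 * k ^ (3 * k - 5) * (k - 1) ^ (k - 2)
     + 40 * k ^ (4 * k - 8))%N%:R.
Proof.
case: k hk => [|[|[|q]]] // _.
rewrite tensor_trace_configs (perm_big _ perm_configs) big_map big_seq.
rewrite (eq_bigr _ (fun p => @root_term_table C q p)) -big_seq sum_config_table.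
(* Writing the exponents through [q.+1], which is k - 2, reduces the claim to a polynomial
   identity. *)
have -> : (q.+3 - 1 = q.+2)%N by lia.
have -> : (3 * q.+3 - 4 = q.+1 * 3 + 2)%N by lia.
have -> : (2 * q.+3 - 3 = q.+1 * 2 + 1)%N by lia.
have -> : (3 * q.+3 - 5 = q.+1 * 3 + 1)%N by lia.
have -> : (q.+3 - 2 = q.+1)%N by lia.
have -> : (4 * q.+3 - 8 = q.+1 * 4)%N by lia.
have <- : q.+2%:R = q.+3%:R - 1 :> C by ring.
rewrite 3!natrD !(natrM _ (_ * _)) !(natrM _ _ (_ ^ _)).
rewrite ![(q.+3 ^ _)%:R]natrX ![(q.+2 ^ _)%:R]natrX [_ ^+ q.+2]exprSr.
rewrite !(exprD _ (_ * _)) !(exprM _ q.+1).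
move: (q.+3%:R) (q.+2%:R) => K K'; move: (K ^+ q.+1) (K' ^+ q.+1) => Y X.
by ring.
Qed.
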